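(* Let $f:\mathcal{C}_n\to\mathbb{R}$, let $p\in(0,1)$ and let $Y\sim\mu_p$. Then for every $t,\delta\in\mathbb{R}$ satisfying $0<\delta<\frac1n\phi_p(t-\delta)$, $$\log\mathbb{P}(f(Y)\ge tn)\le-\phi_p(t-\delta)\left(1-64Ln^{-1/3}\right),$$ where $$L=\frac1\delta\big(2\mathrm{Lip}(f)+|\log(p(1-p))|\big)^{2/3}\left(2\mathcal{D}(f)+\frac1\delta\mathrm{Lip}(f)^2\right)^{1/3}.$$ Moreover, whenever $\frac{1}{n\delta^2}\mathrm{Lip}(f)^2\le\frac12$, one also has $$\log\mathbb{P}(f(Y)\ge(t-\delta)n)\ge-\phi_p(t)\left(1+\frac{2}{n\delta^2}\mathrm{Lip}(f)^2\right)-2.$$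
   Context: $\mathcal{C}_n=\{-1,1\}^n$ with uniform probability measure $\mu$. For $0\le p\le1$, $\mu_p$ is the measure with $\frac{d\mu_p}{d\mu}(y)=\prod_{i\in[n]}(1-y_i(1-2p))$ (i.i.d. coordinates equal to $1$ with probability $p$). For $g:\mathcal{C}_n\to\mathbb{R}$, $\partial_i g(y)=\frac12\big(g(y_1,..,y_{i-1},1,y_{i+1},..,y_n)-g(y_1,..,y_{i-1},-1,y_{i+1},..,y_n)\big)$, $\nabla g=(\partial_1g,\dots,\partial_ng)$, $\mathrm{Lip}(g)=\max_{i,y}|\partial_ig(y)|$, $\mathbf{GW}(K)=\mathbb{E}\sup_{x\in K}\langle x,\Gamma\rangle$ with $\Gamma\sim N(0,\mathrm{Id}_n)$, $\mathcal{D}(g)=\mathbf{GW}(\{\nabla g(y):y\in\mathcal{C}_n\}\cup\{0\})$. The rate function is $\phi_p(t)=\inf\{\mathrm{D}_{\mathrm{KL}}(\xi\Vert\mu_p):\xi\in\mathcal{PM}(\mathcal{C}_n),\ \int f\,d\xi\ge tn\}$, where $\mathcal{PM}(\mathcal{C}_n)$ is the set of product probability measures on $\mathcal{C}_n$ and $\mathrm{D}_{\mathrm{KL}}(\nu_1\Vert\nu_2)=\int\log\frac{d\nu_1}{d\nu_2}d\nu_1$. *)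

(* Defs.v *)
From HB Require Import structures.
From mathcomp Require Import all_boot all_order all_algebra.
From mathcomp Require Import all_classical all_reals all_analysis.
Set Implicit Arguments. Unset Strict Implicit. Unset Printing Implicit Defensive.
Import Order.TTheory GRing.Theory Num.Theory.
Local Open Scope classical_set_scope.
Local Open Scope ring_scope.

Section Defs.
Variable R : realType.

(* The hypercube C_n = {-1,1}^n is represented by {ffun 'I_n -> bool};
   the coordinate y_i in {-1,1} is [spin (y i)] (true |-> 1, false |-> -1). *)
Definition cube (n : nat) := {ffun 'I_n -> bool}.
Definition spin (b : bool) : R := if b then 1 else -1.

Definition mu_p (n : nat) (p : R) (y : cube n) : R :=
  (2 ^+ n)^-1 * \prod_(i < n) (1 - spin (y i) * (1 - 2 * p)).

Definition prob_ge (n : nat) (p : R) (f : cube n -> R) (s : R) : R :=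
  \sum_(y : cube n | s <= f y) mu_p p y.

Definition setc (n : nat) (y : cube n) (i : 'I_n) (b : bool) : cube n :=
  [ffun j => if j == i then b else y j].

Definition dpart (n : nat) (g : cube n -> R) (i : 'I_n) (y : cube n) : R :=
  (g (setc y i true) - g (setc y i false)) / 2.

Definition Lip (n : nat) (g : cube n -> R) : R :=
  \big[Num.max/0]_(i < n) \big[Num.max/0]_(y : cube n) `|dpart g i y|.

(* Iterated expectation with respect to n i.i.d. standard Gaussians
   Gamma_0, ..., Gamma_{n-1} (a Gaussian vector is modelled as nat -> R,
   only the first n coordinates are integrated). *)
Definition upd (g : nat -> R) (k : nat) (x : R) : nat -> R :=
  fun j => if j == k then x else g j.

Fixpoint gauss_iter (k : nat) (F : (nat -> R) -> R) (g : nat -> R) : R :=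
  match k with
  | 0 => F g
  | k'.+1 => fine (\int[normal_prob 0 1]_x (gauss_iter k' F (upd g k' x))%:E)%E
  end.

Definition gauss_expect (n : nat) (F : (nat -> R) -> R) : R :=
  gauss_iter n F (fun _ => 0).

(* GW(K) for K = {grad g(y) : y in C_n} u {0}:
   E sup_{x in K} <x, Gamma> = E max(0, max_y <grad g(y), Gamma>) *)
Definition DD (n : nat) (g : cube n -> R) : R :=
  gauss_expect n (fun G =>
    \big[Num.max/0]_(y : cube n) \sum_(i < n) dpart g i y * G i).

Definition is_product_pm (n : nat) (xi : cube n -> R) : Prop :=
  exists m : 'I_n -> bool -> R,
    (forall i b, 0 <= m i b) /\ (forall i, m i true + m i false = 1) /\
    (forall y, xi y = \prod_(i < n) m i (y i)).

(* Kullback-Leibler divergence D_KL(xi || mu_p) (natural log; terms with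
   xi(y) = 0 contribute 0) *)
Definition KL (n : nat) (p : R) (xi : cube n -> R) : R :=
  \sum_(y : cube n) xi y * ln (xi y / mu_p p y).

Definition phi (n : nat) (p : R) (f : cube n -> R) (t : R) : \bar R :=
  ereal_inf [set (KL p xi)%:E | xi in
     [set xi | is_product_pm xi /\ t * n%:R <= \sum_(y : cube n) f y * xi y]].

Definition elog (x : R) : \bar R := if x == 0 then -oo%E else (ln x)%:E.

End Defs.

(* Main.v *)
Require Import Defs.
From HB Require Import structures.
From mathcomp Require Import all_boot all_order all_algebra.
From mathcomp Require Import all_classical all_reals all_analysis.
From mathcomp Require Import measurable_realfun ring lra.
Import Order.TTheory GRing.Theory Num.Theory.
Import numFieldNormedType.Exports.
Local Open Scope classical_set_scope.
Local Open Scope ring_scope.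

(** Let [M = phi p f (t - delta)] and [lam = M / (delta n)].  For [v] in R^n let
    [Lam v = sum_i ln (p e^(v_i) + (1 - p) e^(- v_i))], and let [K] be the convex
    hull of [0] and of the points [lam * grad f(z)].

    Upper bound.  If [f y >= t n], some [v] in [K] satisfies
    [<v, y> - Lam v >= M].  Take for [v] a maximizer of this concave function on
    [K], and let [xi] be the product measure tilted by [v], with mean [m].  Then
    [<v, y> - Lam v = <v, y - m> + KL xi], and optimality says that
    [<u, y - m> <= <v, y - m>] for all [u] in [K].  Either [xi] satisfies the
    constraint of [phi p f (t - delta)], and then [KL xi >= M] and [u = 0] gives the
    claim; or [f y - E_xi f > delta n], and then by the mean value theorem along the
    segment from [m] to [y] some [z] has [<grad f(z), y - m> > delta n], and
    [u = lam * grad f(z)] gives the claim.  Hence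
    [P(f >= t n) e^M <= E exp (max_v (<v, Y> - Lam v))], the maximum being over
    finitely many [v] in [K].  By the Gibbs variational principle, one coordinate
    at a time, this is at most [exp (E max_v <v, D>)] for some sequence [D] of
    martingale differences with values in [[-2, 2]]; these are dominated in the
    convex order by a multiple of independent Gaussians, so the exponent is at
    most a constant times [lam * DD f].

    Lower bound.  A product measure [xi] admissible for [phi p f t] gives mass at
    least [1 - Lip f ^ 2 / (n delta^2)] to [f >= (t - delta) n], by the Efron-Stein
    and Chebyshev inequalities; conclude with the Gibbs variational principle. *)

Set Implicit Arguments. Unset Strict Implicit. Unset Printing Implicit Defensive.

(** * One-dimensional Gaussian means *)

Section gauss.
Variable R : realType.
Local Notation mu := (@lebesgue_measure R).
Local Notation gam := (@normal_prob R 0 1).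
Implicit Types (h : R -> R).

(** The Radon-Nikodym derivative of the Gaussian law agrees almost everywhere with [normal_pdf],
    since both have the same integral over every measurable set. *)
Lemma ge0_integral_normal (f : R -> \bar R) : (forall x, 0 <= f x)%E ->
  measurable_fun setT f ->
  (\int[gam]_x f x = \int[mu]_x (f x * (normal_pdf 0 1 x)%:E))%E.
Proof.
move=> f0 mf.
have dom := @normal_prob_dominates R 0 1.
rewrite -(Radon_Nikodym_SigmaFinite.change_of_variables dom)//.
have gi := Radon_Nikodym_SigmaFinite.f_integrable dom.
have mp : measurable_fun setT (fun x : R => (normal_pdf 0 1 x)%:E).
  by apply/measurable_EFinP; exact: measurable_normal_pdf.
apply: ae_eq_integral => //.
- by apply: emeasurable_funM => //; exact: measurable_int gi.
- exact: emeasurable_funM.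
apply: ae_eqe_mul2l.
apply: integral_ae_eq => //= E _ mE.
by rewrite -(Radon_Nikodym_SigmaFinite.f_integral dom).
Qed.

(** Domination by the density of standard deviation 2 will make [|x|] integrable. Once the common
    factors are removed, the claim is [|x| <= 2 exp (3/8 x^2)]. *)
Lemma norm_normal_pdf_le (x : R) :
  `|x| * normal_pdf 0 1 x <= 4 * normal_pdf 0 2 x.
Proof.
rewrite !normal_pdfE ?oner_neq0 ?pnatr_eq0//.
have -> : normal_peak (2 : R) = normal_peak 1 / 2.
  rewrite /normal_peak expr1n mul1r -mulrnAr sqrtrM ?sqr_ge0// sqrtr_sqr ger0_norm//.
  by rewrite invfM mulrC.
have -> : 4 * (normal_peak (1:R) / 2 * normal_fun 0 2 x) =
    normal_peak 1 * (2 * normal_fun 0 2 x) by field.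
rewrite mulrCA ler_wpM2l ?normal_peak_ge0//.
rewrite /normal_fun subr0 expr1n.
have -> : - x ^+ 2 / (1 *+ 2) = - (x ^+ 2 / (2 ^+ 2 *+ 2)) - 3 / 8 * x ^+ 2 :> R by field.
rewrite expRD mulrCA [in leRHS]mulNr [leRHS]mulrC ler_wpM2l ?expR_ge0//.
rewrite expRN ler_pdivrMr ?expR_gt0//.
have h1 := expR_ge1Dx (3 / 8 * x ^+ 2).
have h2 : `|x| ^+ 2 = x ^+ 2 by rewrite real_normK ?num_real.
have : 0 <= (`|x| - 1) ^+ 2 by exact: sqr_ge0.
nra.
Qed.

Lemma integrable_norm_normal :
  gam.-integrable setT (fun x => `|x|%:E).
Proof.
have mf : measurable_fun setT (fun x : R => (`|x|)%:E).
  by apply/measurable_EFinP; exact: normr_measurable.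
apply/integrableP; split => //.
under eq_integral do rewrite /= normr_id.
rewrite ge0_integral_normal//.
have mp s : measurable_fun setT (fun x : R => (normal_pdf 0 s x)%:E).
  by apply/measurable_EFinP; exact: measurable_normal_pdf.
apply: (@le_lt_trans _ _ (\int[mu]_x (4%:E * (normal_pdf 0 2 x)%:E))%E).
  apply: ge0_le_integral => //=.
  - by move=> x _; rewrite mule_ge0// lee_fin// normal_pdf_ge0.
  - by apply: (emeasurable_funM mf (mp 1)).
  - by apply: emeasurable_funM (mp 2); exact: measurable_cst.
  - by move=> x _; rewrite -!EFinM lee_fin norm_normal_pdf_le.
rewrite ge0_integralZl//; first by rewrite integral_normal_pdf mule1 ltry.
- exact: (mp 2).
- by move=> x _; rewrite lee_fin normal_pdf_ge0.
Qed.

Definition gauss_mean h : R := (\int[gam]_x h x)%R.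

(** The working class of integrands: its members are integrable for the Gaussian law and it is
    closed under the operations used below, so means can be added, scaled and compared freely. *)
Definition is_lipschitz h := exists C : R, forall x y, `|h x - h y| <= C * `|x - y|.

Lemma is_lipschitz_continuous h : is_lipschitz h -> continuous h.
Proof.
move=> [C hC] x; apply/cvgrPdist_le => e e0.
(* [C] need not be positive, and the division below asks for a positive constant. *)
have C0 : 0 < `|C| + 1 by rewrite ltr_wpDl.
near=> y.
rewrite (le_trans (hC x y))//.
rewrite (@le_trans _ _ ((`|C| + 1) * `|x - y|))//.
  by rewrite ler_wpM2r// (le_trans (ler_norm C))// lerDl.
rewrite mulrC -ler_pdivlMr//.
near: y; apply: cvgr_dist_le; first exact: cvg_id.
exact: divr_gt0.
Unshelve. all: by end_near. Qed.

Lemma integrable_lipschitz h : is_lipschitz h -> gam.-integrable setT (EFin \o h).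
Proof.
move=> lh; have [C hC] := lh.
have int : gam.-integrable setT (EFin \o (fun x : R => `|h 0| + `|C| * `|x|)).
  have : gam.-integrable setT
      (cst (`|h 0|)%:E \+ (fun x : R => (`|C|)%:E * `|x|%:E))%E.
    apply: integrableD => //.
    - exact: finite_measure_integrable_cst.
    - by apply: integrableZl => //; exact: integrable_norm_normal.
  by [].
apply: (le_integrable _ _ _ int) => //.
- apply/measurable_EFinP; apply: continuous_measurable_fun.
  exact: is_lipschitz_continuous.
- move=> x _; rewrite /= lee_fin [leRHS]ger0_norm ?addr_ge0 ?mulr_ge0//.
  rewrite -[in leLHS](subrK (h 0) (h x)) addrC (le_trans (ler_normD _ _))// lerD2l.
  by rewrite (le_trans (hC x 0))// subr0 ler_wpM2r// ler_norm.
Qed.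

Lemma is_lipschitz_cst (c : R) : is_lipschitz (fun=> c).
Proof. by exists 0 => x y; rewrite subrr normr0 mul0r. Qed.

Lemma is_lipschitzD h1 h2 : is_lipschitz h1 -> is_lipschitz h2 ->
  is_lipschitz (fun x => h1 x + h2 x).
Proof.
move=> [C hC] [D hD]; exists (C + D) => x y.
rewrite opprD addrACA mulrDl (le_trans (ler_normD _ _))//.
by rewrite lerD.
Qed.

Lemma is_lipschitzZ (c : R) h : is_lipschitz h -> is_lipschitz (fun x => c * h x).
Proof.
move=> [C hC]; exists (`|c| * C) => x y.
by rewrite -mulrBr normrM -mulrA ler_wpM2l.
Qed.

Lemma is_lipschitz_scale (c : R) h : is_lipschitz h -> is_lipschitz (fun x => h (c * x)).
Proof.
move=> [C hC]; exists (C * `|c|) => x y.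
by rewrite -mulrA -normrM mulrBr hC.
Qed.

Lemma is_lipschitz_norm : is_lipschitz (fun x => `|x|).
Proof. by exists 1 => x y; rewrite mul1r ler_dist_dist. Qed.

Lemma gauss_mean_cst (c : R) : gauss_mean (fun=> c) = c.
Proof.
rewrite /gauss_mean /Rintegral integral_cst//.
by rewrite -[X in (_ * X)%E]/(gam setT) probability_setT mule1.
Qed.

Lemma gauss_meanD h1 h2 : is_lipschitz h1 -> is_lipschitz h2 ->
  gauss_mean (fun x => h1 x + h2 x) = gauss_mean h1 + gauss_mean h2.
Proof. by move=> *; apply: RintegralD => //; exact: integrable_lipschitz. Qed.

Lemma gauss_meanZ (c : R) h : is_lipschitz h -> gauss_mean (fun x => c * h x) = c * gauss_mean h.
Proof. by move=> *; apply: RintegralZl => //; exact: integrable_lipschitz. Qed.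

Lemma le_gauss_mean h1 h2 : is_lipschitz h1 -> is_lipschitz h2 ->
  (forall x, h1 x <= h2 x) -> gauss_mean h1 <= gauss_mean h2.
Proof. by move=> *; apply: le_Rintegral => //; exact: integrable_lipschitz. Qed.

Definition gauss_abs := gauss_mean (fun x => `|x|).

(** The density is at most 1, so the interval from -1/4 to 1/4 has mass at most 1/2; the rest has
    mass at least 1/2, and there [|x| >= 1/4]. The exact value is [sqrt (2 / pi)]. *)
Lemma gauss_abs_ge : 8^-1 <= gauss_abs.
Proof.
pose A := [set x : R | - 4^-1 < x < 4^-1].
have AE : A = `]- 4^-1, 4^-1[%classic by apply/seteqP; split => x /=; rewrite in_itv.
have mA : measurable A by rewrite AE.
have pk1 : normal_peak (1 : R) <= 1.
  have pi1 : 1 <= (pi *+ 2 : R) by have := pi_ge2 R; lra.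
  rewrite /normal_peak expr1n mul1r invf_le1.
    by rewrite -[leLHS]sqrtr1 ler_sqrt// (le_trans ler01 pi1).
  by rewrite sqrtr_gt0 (lt_le_trans ltr01 pi1).
have gA : (gam A <= (2^-1)%:E)%E.
  rewrite /normal_prob (@le_trans _ _ (\int[mu]_(x in A) 1)%E)//.
    apply: ge0_le_integral => //=.
    - by move=> x _; rewrite lee_fin normal_pdf_ge0.
    - apply/measurable_EFinP; apply: measurable_funTS.
      exact: measurable_normal_pdf.
    - move=> x _; rewrite lee_fin (le_trans _ pk1)// normal_pdf_ub// oner_neq0.
  have muA : (mu A <= (2^-1)%:E)%E.
    rewrite AE lebesgue_measure_itv/= lte_fin ifT; last by lra.
    by rewrite -EFinB lee_fin; lra.
  by rewrite integral_cst// mul1e; exact: muA.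
have gAC : ((2^-1)%:E <= gam (~` A))%E.
  rewrite probability_setC// leeBrDr; last first.
    by rewrite ge0_fin_numE// (le_lt_trans gA)// ltry.
  rewrite (@le_trans _ _ ((2^-1)%:E + (2^-1)%:E)%E)//; first by rewrite leeD2l.
  by rewrite -EFinD lee_fin; lra.
have mn : measurable_fun setT (fun x : R => (`|x|)%:E).
  by apply/measurable_EFinP; exact: normr_measurable.
have : ((8^-1)%:E <= \int[gam]_x `|x|%:E)%E.
  apply: (@le_trans _ _ (\int[gam]_(x in ~` A) (4^-1)%:E)%E).
    rewrite integral_cst//; last exact: measurableC.
    rewrite (@le_trans _ _ ((4^-1)%:E * (2^-1)%:E)%E)//.
      by rewrite -EFinM lee_fin; lra.
    by rewrite lee_pmul2l// lte_fin; lra.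
  apply: (@le_trans _ _ (\int[gam]_(x in ~` A) `|x|%:E)%E).
    apply: ge0_le_integral => //=.
    - exact: measurableC.
    - by apply: measurable_funTS.
    - move=> x /negP; rewrite lee_fin -ltr_norml -leNgt//.
  by apply: ge0_subset_integral => //; exact: measurableC.
rewrite -[X in (_ <= X)%E]fineK; last first.
  by apply: integrable_fin_num => //; exact: integrable_norm_normal.
by rewrite lee_fin.
Qed.

End gauss.

(** * Iterated Gaussian means and convex domination by a Gaussian *)

Section gauss2.
Variable R : realType.
Local Notation mu := (@lebesgue_measure R).
Local Notation gam := (@normal_prob R 0 1).
Local Notation Eg := (@gauss_mean R).
Local Notation kap := (@gauss_abs R).

Lemma normal_pdf_opp (x : R) : normal_pdf 0 1 (- x) = normal_pdf 0 1 x.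
Proof. by rewrite !normal_pdfE ?oner_neq0// /normal_fun !subr0 sqrrN. Qed.

(** By symmetry. To stay with nonnegative integrands, [|x| + x] and [|x| - x] are compared: each
    lives on one half-line, and [x -> - x] exchanges them. *)
Lemma gauss_mean_id : Eg id = 0.
Proof.
have lipid : is_lipschitz (@id R) by exists 1 => x y; rewrite mul1r.
have lipn : is_lipschitz (fun x : R => - x).
  by have := is_lipschitzZ (-1) lipid; under [X in is_lipschitz X]eq_fun do rewrite mulN1r.
pose G (x : R) := (`|x| + x) * normal_pdf 0 1 x.
have G0 x : 0 <= G x.
  rewrite mulr_ge0 ?normal_pdf_ge0//.
  by rewrite -lerBlDr sub0r -normrN ler_norm.
have Gc : continuous G.
  move=> x; apply: cvgM; last by apply: continuous_normal_pdf; rewrite oner_neq0.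
  by apply: cvgD; [exact: norm_continuous|exact: cvg_id].
have key : (\int[gam]_x (`|x| + x)%:E = \int[gam]_x (`|x| + - x)%:E)%E.
  have mh (h : R -> R) : is_lipschitz h -> measurable_fun setT (fun x => (h x)%:E).
    move=> lh; apply/measurable_EFinP; apply: continuous_measurable_fun.
    exact: is_lipschitz_continuous.
  rewrite !ge0_integral_normal//.
  - transitivity (\int[mu]_(x in `[0%R, +oo[) (G x)%:E)%E.
      rewrite [RHS]integral_mkcond; apply: eq_integral => x _.
      rewrite patchE/= mem_setE in_itv/= andbT; case: ifPn => // x0.
      by rewrite ltr0_norm ?ltNge// addNr mul0e.
    have -> : (\int[mu]_(x in `[0%R, +oo[) (G x)%:E)%E =
        (\int[mu]_(x in `]-oo, 0%R]) (G (- x)%R)%:E)%E.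
      rewrite -[X in `]-oo, X]]oppr0 ge0_integration_by_substitutionNy//.
      - by apply: eq_integral => x _; rewrite /= opprK.
      - apply: continuous_subspaceT => x.
        by apply: (@continuous_comp _ _ _ -%R G); [exact: opp_continuous|exact: Gc].
    rewrite [LHS]integral_mkcond; apply: eq_integral => x _.
    rewrite patchE/= mem_setE in_itv/=; case: ifPn => [x0|].
      by rewrite /G normrN normal_pdf_opp.
    by rewrite -ltNge => x0; rewrite gtr0_norm// subrr mul0e.
  - by move=> x; rewrite lee_fin subr_ge0 ler_norm.
  - by apply: mh; apply: is_lipschitzD => //; exact: is_lipschitz_norm.
  - by move=> x; rewrite lee_fin -lerBlDr sub0r -normrN ler_norm.
  - by apply: mh; apply: is_lipschitzD => //; exact: is_lipschitz_norm.
have : Eg (fun x => `|x| + x) = Eg (fun x => `|x| + - x) by rewrite /gauss_mean /Rintegral key.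
rewrite !gauss_meanD//; [|exact: is_lipschitz_norm|exact: is_lipschitz_norm].
have -> : Eg -%R = - Eg id.
  rewrite -[RHS]mulN1r -gauss_meanZ//; congr Eg; apply/funext => x; by rewrite mulN1r.
move=> /addrI; lra.
Qed.

(** Such an [F] depends on the first [N] coordinates only. The property passes to every partial
    iterate of [gauss_iter], with the same [C], and makes each one-dimensional integral
    meaningful. *)
Definition l1_lipschitz (C : R) (N : nat) (F : (nat -> R) -> R) :=
  forall g h, `|F g - F h| <= C * \sum_(i < N) `|g i - h i|.

Lemma updE (g : nat -> R) k x : upd g k x k = x.
Proof. by rewrite /upd eqxx. Qed.

Lemma upd_neq (g : nat -> R) k x i : i != k -> upd g k x i = g i.
Proof. by rewrite /upd => /negbTE ->. Qed.

Lemma is_lipschitz_upd C N F g k : 0 <= C -> l1_lipschitz C N F ->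
  is_lipschitz (fun x => F (upd g k x)).
Proof.
move=> C0 hF; exists (C * N%:R) => x y.
rewrite (le_trans (hF _ _))// -mulrA ler_wpM2l//.
rewrite -[X in X%:R * _]card_ord mulr_natl -sumr_const ler_sum// => i _.
by rewrite /upd; case: ifP => // _; rewrite subrr normr0.
Qed.

Lemma gauss_iterS k (F : (nat -> R) -> R) g :
  gauss_iter k.+1 F g = Eg (fun x => gauss_iter k F (upd g k x)).
Proof. by []. Qed.

Lemma l1_lipschitz_gauss_iter C N F k : 0 <= C -> l1_lipschitz C N F ->
  l1_lipschitz C N (gauss_iter k F).
Proof.
move=> C0 hF; elim: k => [//|k IH] g h.
have lg g' : is_lipschitz (fun x => gauss_iter k F (upd g' k x)) by exact: is_lipschitz_upd IH.
suff le g1 g2 : gauss_iter k.+1 F g1 <=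
    gauss_iter k.+1 F g2 + C * \sum_(i < N) `|g1 i - g2 i|.
  rewrite ler_distl le lerBlDr (le_trans (le h g))// lerD2l ler_wpM2l//.
  by apply: ler_sum => i _; rewrite distrC.
rewrite !gauss_iterS -[X in _ + X]gauss_mean_cst -gauss_meanD//; last exact: is_lipschitz_cst.
apply: le_gauss_mean => //; first by apply: is_lipschitzD => //; exact: is_lipschitz_cst.
move=> x; rewrite -lerBlDl (le_trans (ler_norm _))// (le_trans (IH _ _))// ler_wpM2l//.
apply: ler_sum => i _; rewrite /upd; case: ifP => // _.
by rewrite subrr normr0.
Qed.

(** The comparison is asked only at the points that the iteration visits: coordinates below [k] are
    common to both sides, the others are frozen at [g] and [g']. This lets a last coordinate already
    fixed be absorbed into the integrand. *)
Lemma le_gauss_iter C N C' N' F F' k g g' : 0 <= C -> 0 <= C' ->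
  l1_lipschitz C N F -> l1_lipschitz C' N' F' ->
  (forall h h', (forall i, (i < k)%N -> h i = h' i) ->
     (forall i, (k <= i)%N -> h i = g i) -> (forall i, (k <= i)%N -> h' i = g' i) ->
     F h <= F' h') ->
  gauss_iter k F g <= gauss_iter k F' g'.
Proof.
move=> C0 C0' lF lF'; elim: k g g' => [|k IH] g g' H; first exact: H.
rewrite !gauss_iterS; apply: le_gauss_mean.
- exact: (is_lipschitz_upd _ _ C0 (l1_lipschitz_gauss_iter _ C0 lF)).
- exact: (is_lipschitz_upd _ _ C0' (l1_lipschitz_gauss_iter _ C0' lF')).
move=> x; apply: IH => h h' hh' hg hg'; apply: H.
- move=> i; rewrite ltnS leq_eqVlt => /predU1P[->|/hh'//].
  by rewrite hg// hg'// !updE.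
- by move=> i ki; rewrite hg 1?ltnW// upd_neq// gtn_eqF.
- by move=> i ki; rewrite hg' 1?ltnW// upd_neq// gtn_eqF.
Qed.

Lemma eq_gauss_iter C N C' N' F F' k g g' : 0 <= C -> 0 <= C' ->
  l1_lipschitz C N F -> l1_lipschitz C' N' F' ->
  (forall h h', (forall i, (i < k)%N -> h i = h' i) ->
     (forall i, (k <= i)%N -> h i = g i) -> (forall i, (k <= i)%N -> h' i = g' i) ->
     F h = F' h') ->
  gauss_iter k F g = gauss_iter k F' g'.
Proof.
move=> C0 C0' lF lF' H; apply: le_anti; apply/andP; split.
  by apply: (le_gauss_iter C0 C0' lF lF') => h h' *; rewrite (H h h').
apply: (le_gauss_iter C0' C0 lF' lF) => h h' hh' *; rewrite (H h' h)//.
by move=> i ik; rewrite hh'.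
Qed.

Lemma gauss_iterD C N C' N' F F' k g : 0 <= C -> 0 <= C' ->
  l1_lipschitz C N F -> l1_lipschitz C' N' F' ->
  gauss_iter k (fun G => F G + F' G) g = gauss_iter k F g + gauss_iter k F' g.
Proof.
move=> C0 C0' lF lF'; elim: k g => [//|k IH] g; rewrite !gauss_iterS -gauss_meanD.
- by congr Eg; apply/funext => x; rewrite IH.
- exact: (is_lipschitz_upd _ _ C0 (l1_lipschitz_gauss_iter _ C0 lF)).
- exact: (is_lipschitz_upd _ _ C0' (l1_lipschitz_gauss_iter _ C0' lF')).
Qed.

Lemma gauss_iterZ C N F k g c : 0 <= C -> l1_lipschitz C N F ->
  gauss_iter k (fun G => c * F G) g = c * gauss_iter k F g.
Proof.
move=> C0 lF; elim: k g => [//|k IH] g; rewrite !gauss_iterS -gauss_meanZ.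
- by congr Eg; apply/funext => x; rewrite IH.
- exact: (is_lipschitz_upd _ _ C0 (l1_lipschitz_gauss_iter _ C0 lF)).
Qed.

Lemma gauss_iter_cst (c : R) k g : gauss_iter k (fun=> c) g = c.
Proof.
elim: k g => [//|k IH] g; rewrite gauss_iterS -[RHS]gauss_mean_cst.
by congr Eg; apply/funext => x; rewrite IH.
Qed.

Lemma l1_lipschitz_cst (c : R) : l1_lipschitz 0 0 (fun=> c).
Proof. by move=> g h; rewrite subrr normr0 mul0r. Qed.

Lemma l1_lipschitz_sum_norm N : l1_lipschitz 1 N (fun G => \sum_(i < N) `|G i|).
Proof.
move=> g h; rewrite mul1r -sumrB (le_trans (ler_norm_sum _ _ _))//.
by apply: ler_sum => i _; exact: ler_dist_dist.
Qed.

Lemma l1_lipschitz_coord_norm k : l1_lipschitz 1 k.+1 (fun G => `|G k|).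
Proof.
move=> g h; rewrite mul1r (le_trans (ler_dist_dist _ _))// big_ord_recr/= lerDr.
exact: sumr_ge0.
Qed.

Lemma gauss_iter_sum_norm k g :
  gauss_iter k (fun G => \sum_(i < k) `|G i|) g = k%:R * kap.
Proof.
elim: k g => [|k IH] g; first by rewrite /= big_ord0 mul0r.
have -> : gauss_iter k.+1 (fun G => \sum_(i < k.+1) `|G i|) g =
    Eg (fun x => k%:R * kap + `|x|).
  rewrite gauss_iterS; congr Eg; apply/funext => x.
  under [F in gauss_iter _ F]eq_fun do rewrite big_ord_recr/=.
  rewrite (gauss_iterD _ _ ler01 ler01 (@l1_lipschitz_sum_norm k) (@l1_lipschitz_coord_norm k)) IH.
  congr (_ + _); rewrite -[RHS](gauss_iter_cst _ k (upd g k x)).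
  apply: (eq_gauss_iter ler01 (lexx 0) (@l1_lipschitz_coord_norm k) (@l1_lipschitz_cst _)).
  by move=> h h' _ -> //; rewrite updE.
rewrite gauss_meanD; [|exact: is_lipschitz_cst|exact: is_lipschitz_norm].
by rewrite gauss_mean_cst -natr1 mulrDl mul1r.
Qed.

(* The optimal factor is [2 / kap], by a subgradient argument; [6 / kap] only
   needs the elementary bound [lin] below. *)
Lemma convex_le_gauss_mean (Psi : R -> R) : is_lipschitz Psi ->
  (forall th x y, 0 <= th <= 1 ->
     Psi (th * x + (1 - th) * y) <= th * Psi x + (1 - th) * Psi y) ->
  (Psi 2 + Psi (-2)) / 2 <= Eg (fun x => Psi (6 / kap * x)).
Proof.
move=> lP cP.
have k0 : 0 < kap by rewrite (lt_le_trans _ (gauss_abs_ge R))// invr_gt0.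
set dp := Psi 2 - Psi 0; set dm := Psi (- 2) - Psi 0.
have d0 : 0 <= dp + dm.
  have := cP (1/2) 2 (-2); rewrite (_ : 1/2 * 2 + (1 - 1/2) * -2 = 0); last by lra.
  have h : 0 <= (1/2 : R) <= 1 by lra.
  by move=> /(_ h); rewrite /dp /dm; lra.
(* The minorant has slope [dp / 2] on the right and [- dm / 2] on the left, lowered by [dp + dm].
   Chords extended beyond 2 and -2 ([far]) and chords across 0 ([near]) prove it. The factor 6 makes
   its mean equal to [Psi 0 - (dp + dm) + 6 / 4 * (dp + dm)], which is [(Psi 2 + Psi (-2)) / 2]. *)
have lin x : Psi 0 - (dp + dm) + ((dp - dm) / 4 * x + (dp + dm) / 4 * `|x|) <= Psi x.
  have far y e : e = 2 \/ e = -2 -> 1 <= y -> Psi 0 + y * (Psi e - Psi 0) <= Psi (y * e).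
    move=> _ y1; have y0 : 0 < y by rewrite (lt_le_trans ltr01).
    have h : 0 <= y^-1 <= 1 by rewrite invr_ge0 ltW//= invf_le1.
    have := cP y^-1 (y * e) 0 h; rewrite mulr0 addr0 mulrA mulVf ?gt_eqF// mul1r => H.
    have : y * Psi e <= y * (y^-1 * Psi (y * e) + (1 - y^-1) * Psi 0) by rewrite ler_pM2l.
    by rewrite mulrDr !mulrA mulfV ?gt_eqF// mul1r mulrBr mulfV ?gt_eqF// mulr1; lra.
  have near y e : 0 <= y <= 1 -> Psi 0 - y * (Psi (- e) - Psi 0) <= Psi (y * e).
    move=> /andP[y0 y1]; have y01 : 0 < y + 1 by lra.
    have h : 0 <= (y + 1)^-1 <= 1 by rewrite invr_ge0 ltW//= invf_le1//; lra.
    have := cP (y + 1)^-1 (y * e) (- e) h.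
    have -> : (y + 1)^-1 * (y * e) + (1 - (y + 1)^-1) * - e = 0 by field; lra.
    move=> H; have : (y + 1) * Psi 0 <= (y + 1) * ((y + 1)^-1 * Psi (y * e)
       + (1 - (y + 1)^-1) * Psi (- e)) by rewrite ler_pM2l.
    rewrite [leRHS](_ : _ = Psi (y * e) + y * Psi (- e)); last by field; lra.
    lra.
  have [x0|x0] := leP 0 x.
    rewrite ger0_norm//.
    have [x2|x2] := leP 2 x.
      have := far (x / 2) 2; rewrite divfK ?pnatr_eq0// => /(_ (or_introl erefl)).
      have h : 1 <= x / 2 by lra.
      by move=> /(_ h); rewrite -/dp; nra.
    have h : 0 <= x / 2 <= 1 by lra.
    have := near (x / 2) 2 h; rewrite divfK ?pnatr_eq0// -/dm; nra.
  rewrite ltr0_norm//.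
  have xE : x = - x / 2 * -2 by lra.
  have [x2|x2] := leP x (-2).
    have := far (- x / 2) (-2) (or_intror erefl); rewrite -xE.
    have h : 1 <= - x / 2 by lra.
    by move=> /(_ h); rewrite -/dm; nra.
  have h : 0 <= - x / 2 <= 1 by lra.
  have := near (- x / 2) (-2) h; rewrite -xE opprK -/dp; nra.
have lipid : is_lipschitz (@id R) by exists 1 => x y; rewrite mul1r.
pose a := (dp - dm) / 4; pose b := (dp + dm) / 4.
have l1 : is_lipschitz (fun x => a * (6 / kap * x)).
  by apply: is_lipschitzZ; exact: (is_lipschitz_scale _ lipid).
have l2 : is_lipschitz (fun x : R => b * `|6 / kap * x|).
  by apply: is_lipschitzZ; exact: (is_lipschitz_scale _ (@is_lipschitz_norm R)).
have /le_trans-> // : (Psi 2 + Psi (-2)) / 2 <=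
    Eg (fun x => Psi 0 - (dp + dm) + (a * (6 / kap * x) + b * `|6 / kap * x|)).
  rewrite (gauss_meanD (is_lipschitz_cst (Psi 0 - (dp + dm))) (is_lipschitzD l1 l2)).
  rewrite (gauss_meanD l1 l2) gauss_mean_cst.
  rewrite (gauss_meanZ a (is_lipschitz_scale (6 / kap) lipid)) (gauss_meanZ (6 / kap) lipid).
  rewrite (gauss_meanZ b (is_lipschitz_scale (6 / kap) (@is_lipschitz_norm R))).
  rewrite gauss_mean_id !mulr0 add0r.
  have -> : (fun x => `|6 / kap * x|) = (fun x => 6 / kap * `|x|).
    by apply/funext => x; rewrite normrM gtr0_norm// divr_gt0.
  rewrite gauss_meanZ; last exact: is_lipschitz_norm.
  by rewrite -/kap divfK ?gt_eqF// /b /dp /dm; lra.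
apply: le_gauss_mean => [||x]; last exact: lin.
- by apply: is_lipschitzD; [exact: is_lipschitz_cst|exact: is_lipschitzD].
- exact: is_lipschitz_scale.
Qed.

End gauss2.

(** * Exponential moments of maxima of linear forms *)

Section pos_max.
Variables (R : realType) (T : finType).
Implicit Types b : T -> R.

(** The starting value 0 accounts for the point 0 adjoined to the set of gradients. *)
Definition pos_max b := \big[Num.max/0]_t b t.

Lemma pos_max_ge0 b : 0 <= pos_max b.
Proof. exact: bigmax_ge_id. Qed.

Lemma le_pos_max b t : b t <= pos_max b.
Proof. exact: le_bigmax. Qed.

Lemma pos_max_le b x : 0 <= x -> (forall t, b t <= x) -> pos_max b <= x.
Proof. by move=> x0 bx; apply: bigmax_le. Qed.

Lemma pos_max_leD b b' c : 0 <= c -> (forall t, b t <= b' t + c) ->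
  pos_max b <= pos_max b' + c.
Proof.
move=> c0 H; apply: pos_max_le => [|t]; first by rewrite addr_ge0// pos_max_ge0.
by rewrite (le_trans (H t))// lerD2r le_pos_max.
Qed.

Lemma l1_lipschitz_pos_max (b : T -> R) (u : T -> nat -> R) N :
  l1_lipschitz (\sum_t \sum_(i < N) `|u t i|) N
    (fun G => pos_max (fun t => b t + \sum_(i < N) u t i * G i)).
Proof.
set C := \sum_t _.
suff le g h : pos_max (fun t => b t + \sum_(i < N) u t i * g i) <=
    pos_max (fun t => b t + \sum_(i < N) u t i * h i) + C * \sum_(i < N) `|g i - h i|.
  move=> g h; rewrite ler_distl le lerBlDr (le_trans (le h g))// lerD2l ler_wpM2l//.
    by apply: sumr_ge0 => t _; exact: sumr_ge0.
  by apply: ler_sum => i _; rewrite distrC.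
apply: pos_max_leD.
  by rewrite mulr_ge0// ?sumr_ge0// => t _; exact: sumr_ge0.
move=> t; rewrite -addrA lerD2l -lerBlDl -sumrB mulr_sumr.
apply: ler_sum => i _; rewrite -mulrBr (le_trans (ler_norm _))// normrM ler_wpM2r//.
rewrite /C (bigD1 t)//= (bigD1 i)//= -addrA lerDl addr_ge0// ?sumr_ge0// => s _.
exact: sumr_ge0.
Qed.

Lemma sum_norm_ge0 (u : T -> nat -> R) N : 0 <= \sum_t \sum_(i < N) `|u t i|.
Proof. by apply: sumr_ge0 => t _; exact: sumr_ge0. Qed.

End pos_max.

(** * Iterated two-point sums *)

Section weighted_iteration.
Variable R : realType.

Definition updb (g : nat -> bool) (k : nat) (b : bool) : nat -> bool :=
  fun j => if j == k then b else g j.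

(** The two-point counterpart of [gauss_iter], with the same order of coordinates, so that one
    induction can treat both. The weights are arbitrary reals, which allows differentiating along a
    line of weights. *)
Fixpoint witer (w : nat -> bool -> R) (k : nat) (F : (nat -> bool) -> R)
    (g : nat -> bool) : R :=
  match k with
  | 0 => F g
  | k'.+1 => w k' true * witer w k' F (updb g k' true) +
             w k' false * witer w k' F (updb g k' false)
  end.

Lemma updbE g k b : updb g k b k = b.
Proof. by rewrite /updb eqxx. Qed.

Lemma updb_neq g k b i : i != k -> updb g k b i = g i.
Proof. by rewrite /updb => /negbTE ->. Qed.

Lemma eq_witer w F F' k g g' :
  (forall h h', (forall i, (i < k)%N -> h i = h' i) ->
     (forall i, (k <= i)%N -> h i = g i) -> (forall i, (k <= i)%N -> h' i = g' i) ->
     F h = F' h') ->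
  witer w k F g = witer w k F' g'.
Proof.
elim: k g g' => [|k IH] g g' H /=; first exact: H.
have E b : witer w k F (updb g k b) = witer w k F' (updb g' k b).
  apply: IH => h h' hh' hg hg'; apply: H.
  - move=> i; rewrite ltnS leq_eqVlt => /predU1P[->|/hh'//].
    by rewrite hg// hg'// !updbE.
  - by move=> i ki; rewrite hg 1?ltnW// updb_neq// gtn_eqF.
  - by move=> i ki; rewrite hg' 1?ltnW// updb_neq// gtn_eqF.
by rewrite !E.
Qed.

End weighted_iteration.

(** * From exponential moments on the cube to Gaussian suprema *)

Section mean_field.
Variable R : realType.
Local Notation Eg := (@gauss_mean R).
Local Notation kap := (@gauss_abs R).
Local Notation spin := (@spin R).

(** The cumulant generating function of one coordinate under [mu_p]. *)
Definition log_laplace (p v : R) : R := ln (p * expR v + (1 - p) * expR (- v)).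

Lemma two_point_laplace_gt0 (p v w : R) : 0 < p < 1 -> 0 < p * expR v + (1 - p) * expR w.
Proof. by move=> /andP[p0 p1]; rewrite addr_gt0// mulr_gt0 ?expR_gt0// subr_gt0. Qed.

Lemma expR_log_laplace (p v : R) : 0 < p < 1 ->
  expR (log_laplace p v) = p * expR v + (1 - p) * expR (- v).
Proof. by move=> p01; rewrite lnK// posrE two_point_laplace_gt0. Qed.

Lemma log_laplace0 p : 0 < p < 1 -> log_laplace p 0 = 0.
Proof.
by move=> p01; rewrite /log_laplace oppr0 expR0 !mulr1 (_ : p + (1 - p) = 1) ?ln1//; lra.
Qed.

(** The Gibbs variational principle on two points: [q] is the weight of the tilted law and [kl] its
    relative entropy with respect to the weights [p], [1 - p]. The last claim is the dual inequality
    for linear test functions, obtained by averaging [1 + u <= exp u]. *)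
Lemma two_point_gibbs (p S1 S2 : R) : 0 < p < 1 -> exists q kl : R,
  [/\ 0 <= q <= 1,
      p * expR S1 + (1 - p) * expR S2 = expR (q * S1 + (1 - q) * S2 - kl) &
      forall v, (2 * q - 1) * v - log_laplace p v <= kl].
Proof.
move=> p01; have /andP[p0 p1] := p01.
set Z := p * expR S1 + (1 - p) * expR S2.
have Z0 : 0 < Z by exact: two_point_laplace_gt0.
pose q := p * expR S1 / Z.
have qE : 1 - q = (1 - p) * expR S2 / Z by rewrite /q /Z; field; rewrite gt_eqF.
have q0 : 0 <= q by rewrite divr_ge0 ?ltW// mulr_gt0// expR_gt0.
have q1 : 0 <= 1 - q by rewrite qE divr_ge0 ?ltW// mulr_gt0 ?expR_gt0// subr_gt0.
exists q, (q * S1 + (1 - q) * S2 - ln Z); split; first by lra.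
  by rewrite subKr lnK.
move=> v.
have L := expR_log_laplace v p01.
have eZ : expR (ln Z) = Z by rewrite lnK.
have e0 x : expR x != 0 :> R by rewrite gt_eqF ?expR_gt0.
pose u1 := v - S1 + ln Z - log_laplace p v; pose u2 := - v - S2 + ln Z - log_laplace p v.
have E : q * expR u1 + (1 - q) * expR u2 = 1.
  rewrite qE /q /u1 /u2 !expRD !(expRN (log_laplace _ _)) !(expRN S1) !(expRN S2) eZ.
  have := e0 (log_laplace p v); rewrite L => L0.
  by field; rewrite L0 !e0 gt_eqF.
have h1 := expR_ge1Dx u1; have h2 := expR_ge1Dx u2.
have : q * (1 + u1) + (1 - q) * (1 + u2) <= 1.
  by rewrite -[leRHS]E; apply: lerD; rewrite ler_wpM2l.
rewrite /u1 /u2; nra.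
Qed.

Definition pweight (p : R) (i : nat) (b : bool) : R := if b then p else 1 - p.

Variable T : finType.

(** Induction on the number of coordinates, peeling off the last one. The Gibbs principle turns its
    two-point average into a centred variable with values in [-2, 2], which [convex_le_gauss_mean]
    replaces by a scaled Gaussian. The offset [a] carries the coordinates already treated. *)
Lemma exp_pos_max_le (p : R) (v : T -> nat -> R) k (a : T -> R) g0 G0 : 0 < p < 1 ->
  witer (pweight p) k (fun g => expR (pos_max (fun t =>
     a t + \sum_(i < k) (v t i * spin (g i) - log_laplace p (v t i))))) g0
  <= expR (gauss_iter k (fun G => pos_max (fun t =>
     a t + \sum_(i < k) 6 / kap * v t i * G i)) G0).
Proof.
move=> p01; have /andP[p0 p1] := p01.
elim: k a g0 G0 => [|k IH] a g0 G0.
  rewrite /= ler_expR le_eqVlt; apply/orP; left; apply/eqP; congr pos_max.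
  by apply/funext => t; rewrite !big_ord0.
set c := 6 / kap.
pose u t i := c * v t i.
pose S b := gauss_iter k (fun G => pos_max (fun t =>
   (a t + (v t k * spin b - log_laplace p (v t k))) + \sum_(i < k) u t i * G i)) G0.
pose Psi x := gauss_iter k (fun G => pos_max (fun t =>
   (a t + v t k * x) + \sum_(i < k) u t i * G i)) G0.
pose C := \sum_t \sum_(i < k) `|u t i|.
have C0 : 0 <= C by exact: sum_norm_ge0.
have lF b : l1_lipschitz C k (fun G => pos_max (fun t => b t + \sum_(i < k) u t i * G i)).
  exact: l1_lipschitz_pos_max.
have lFc b (e : R) : l1_lipschitz C k
    (fun G => pos_max (fun t => b t + \sum_(i < k) u t i * G i) + e).
  by move=> g h; rewrite opprD addrACA subrr addr0; exact: lF.
have shift b b' (e : R) : 0 <= e -> (forall t, b t <= b' t + e) ->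
   gauss_iter k (fun G => pos_max (fun t => b t + \sum_(i < k) u t i * G i)) G0
   <= gauss_iter k (fun G => pos_max (fun t => b' t + \sum_(i < k) u t i * G i)) G0 + e.
  move=> e_ge0 bb'; rewrite -[X in _ + X](gauss_iter_cst e k G0).
  rewrite -(gauss_iterD _ _ C0 (lexx 0) (lF b') (@l1_lipschitz_cst _ e)).
  apply: (le_gauss_iter C0 C0 (lF b) (lFc b' e)) => h h' hh' _ _.
  apply: pos_max_leD => // t; rewrite addrAC lerD//.
  by rewrite le_eqVlt; apply/orP; left; apply/eqP/eq_bigr => i _; rewrite hh'.
have stepE b : witer (pweight p) k (fun g => expR (pos_max (fun t =>
     a t + \sum_(i < k.+1) (v t i * spin (g i) - log_laplace p (v t i))))) (updb g0 k b)
   <= expR (S b).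
  apply: le_trans (IH (fun t => a t + (v t k * spin b - log_laplace p (v t k))) g0 G0).
  rewrite le_eqVlt; apply/orP; left; apply/eqP; apply: eq_witer => h h' hh' hg _.
  congr (expR (pos_max _)); apply/funext => t.
  rewrite big_ord_recr/= hg// updbE.
  under eq_bigr => i _ do rewrite hh'//.
  by rewrite -[RHS]addrA [X in _ = _ + X]addrC.
have rhsE : gauss_iter k.+1 (fun G => pos_max (fun t =>
     a t + \sum_(i < k.+1) c * v t i * G i)) G0 = Eg (fun x => Psi (c * x)).
  rewrite gauss_iterS; congr Eg; apply/funext => x.
  apply: (eq_gauss_iter (sum_norm_ge0 u k.+1) C0 (l1_lipschitz_pos_max a u k.+1) (lF _)).
  move=> h h' hh' hg _; congr pos_max; apply/funext => t.
  rewrite big_ord_recr/= hg// updE.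
  under eq_bigr => i _ do rewrite hh'//.
  by rewrite -[RHS]addrA [X in _ = _ + X]addrC mulrA [X in _ = _ + (_ + X * _)]mulrC.
rewrite rhsE /= (le_trans (lerD (ler_wpM2l _ (stepE true)) (ler_wpM2l _ (stepE false))))//;
  rewrite /pweight; [exact: ltW|by rewrite subr_ge0 ltW|].
have [q [kl [q01 -> klP]]] := two_point_gibbs (S true) (S false) p01.
rewrite ler_expR.
have kl0 : 0 <= kl by have := klP 0; rewrite log_laplace0// mulr0 subrr.
(* By [klP], the term [v * spin - log_laplace] is at most [v * (spin - (2 * q - 1)) + kl]. The
   centred spin takes the values [2 * (1 - q)] and [- (2 * q)], and the [kl] paid here cancels the
   [- kl] in the Gibbs identity. *)
have S1 : S true <= Psi (2 * (1 - q)) + kl.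
  apply: shift => // t; rewrite -addrA lerD2l /spin; have := klP (v t k); lra.
have S2 : S false <= Psi (- (2 * q)) + kl.
  apply: shift => // t; rewrite -addrA lerD2l /spin; have := klP (v t k); lra.
have cPsi th x y : 0 <= th <= 1 ->
     Psi (th * x + (1 - th) * y) <= th * Psi x + (1 - th) * Psi y.
  move=> /andP[th0 th1]; rewrite /Psi.
  rewrite -(gauss_iterZ _ _ _ C0 (lF _)) -(gauss_iterZ _ _ _ C0 (lF _)).
  have lFZ b (e : R) : l1_lipschitz (`|e| * C) k
      (fun G => e * pos_max (fun t => b t + \sum_(i < k) u t i * G i)).
    by move=> g h; rewrite -mulrBr normrM -mulrA ler_wpM2l//; exact: lF.
  have eC0 (e : R) : 0 <= `|e| * C by rewrite mulr_ge0.
  rewrite -(gauss_iterD _ _ (eC0 _) (eC0 _) (lFZ _ _) (lFZ _ _)).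
  apply: (@le_gauss_iter _ C k (`|th| * C + `|1 - th| * C) k) => //.
  - by rewrite addr_ge0.
  - move=> g h; rewrite opprD addrACA [leRHS]mulrDl (le_trans (ler_normD _ _))//.
    by apply: lerD; exact: lFZ.
  move=> h h' hh' _ _; apply: pos_max_le => [|t].
    by rewrite addr_ge0// mulr_ge0 ?pos_max_ge0 ?subr_ge0.
  have -> : \sum_(i < k) u t i * h i = \sum_(i < k) u t i * h' i.
    by apply: eq_bigr => i _; rewrite hh'.
  set s := \sum_(i < k) _.
  have -> : a t + v t k * (th * x + (1 - th) * y) + s =
     th * (a t + v t k * x + s) + (1 - th) * (a t + v t k * y + s) by ring.
  by apply: lerD; rewrite ler_wpM2l ?subr_ge0//;
    [exact: (le_pos_max (fun t => a t + v t k * x + \sum_(i < k) u t i * h' i))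
    |exact: (le_pos_max (fun t => a t + v t k * y + \sum_(i < k) u t i * h' i))].
have lPsi : is_lipschitz Psi.
  exists (\sum_t `|v t k|).
  suff le x y : Psi x <= Psi y + (\sum_t `|v t k|) * `|x - y|.
    by move=> x y; rewrite ler_distl le lerBlDr distrC le.
  apply: shift => [|t]; first by rewrite mulr_ge0// sumr_ge0.
  rewrite -addrA lerD2l -lerBlDl -mulrBr (le_trans (ler_norm _))// normrM ler_wpM2r//.
  by rewrite (bigD1 t)//= lerDl sumr_ge0.
apply: le_trans (convex_le_gauss_mean lPsi cPsi).
(* Both values are written as mixtures of 2 and -2. Averaged with weights [q] and [1 - q], the
   mixtures put exactly mass 1/2 on each endpoint, because the variable is centred. *)
have h1 : 0 <= (2 - q) / 2 <= 1 by lra.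
have h2 : 0 <= (1 - q) / 2 <= 1 by lra.
have := cPsi _ 2 (-2) h1; have := cPsi _ 2 (-2) h2.
rewrite (_ : (1 - q) / 2 * 2 + (1 - (1 - q) / 2) * -2 = - (2 * q)); last by field.
rewrite (_ : (2 - q) / 2 * 2 + (1 - (2 - q) / 2) * -2 = 2 * (1 - q)); last by field.
move=> P2 P1.
have q0 : 0 <= q by lra.
have q1 : 0 <= 1 - q by lra.
have := ler_wpM2l q0 (le_trans S1 (lerD P1 (lexx kl))).
have := ler_wpM2l q1 (le_trans S2 (lerD P2 (lexx kl))).
nra.
Qed.

End mean_field.

(** * Product measures on the cube *)

Section cube_sums.
Variable R : realType.
Local Notation spin := (@spin R).

Definition glue n (z : cube n) (b : bool) : cube n.+1 :=
  [ffun i => if unlift ord_max i is Some j then z j else b].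

Lemma glue_lift n (z : cube n) b j : glue z b (lift ord_max j) = z j.
Proof. by rewrite ffunE liftK. Qed.

Lemma glue_max n (z : cube n) b : glue z b ord_max = b.
Proof. by rewrite ffunE unlift_none. Qed.

Definition restr n (g : nat -> bool) : cube n := [ffun i : 'I_n => g i].

Lemma glue_restr n g : glue (restr n g) (g n) = restr n.+1 g.
Proof.
apply/ffunP => i; rewrite !ffunE.
case: unliftP => [j|] ->; last by [].
by rewrite ffunE lift_max.
Qed.

(** The cube of dimension [n.+1] is split as last coordinate and rest. The base point [g] is
    arbitrary, since all [n] coordinates are overwritten. *)
Lemma sum_cube_witer (w : nat -> bool -> R) n (f : cube n -> R) g :
  \sum_(y : cube n) (\prod_(i < n) w i (y i)) * f y = witer w n (f \o restr n) g.
Proof.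
elim: n f g => [|n IH] f g.
  rewrite /= (bigD1 (restr 0 g))//= big_ord0 mul1r big1 ?addr0// => y /eqP[].
  by apply/ffunP => -[].
pose h (zb : bool * cube n) := glue zb.2 zb.1.
have hb : bijective h.
  exists (fun y : cube n.+1 => (y ord_max, [ffun j : 'I_n => y (lift ord_max j)] : cube n)).
    move=> [b z]; rewrite /h/= glue_max; congr pair.
    by apply/ffunP => j; rewrite ffunE glue_lift.
  move=> y; apply/ffunP => i; rewrite ffunE /=.
  by case: unliftP => [j|] ->//; rewrite ffunE.
rewrite (reindex h) /=; last exact: onW_bij.
rewrite -(pair_bigA _ (fun b z => (\prod_(i < n.+1) w i (glue z b i)) * f (glue z b)))/=.
have E b : \sum_(z : cube n) (\prod_(i < n.+1) w i (glue z b i)) * f (glue z b) =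
    w n b * witer w n (f \o restr n.+1) (updb g n b).
  rewrite (_ : witer _ _ _ _ = witer w n ((fun z => f (glue z b)) \o restr n) g); last first.
    apply: eq_witer => k k' kk' kg _ /=; rewrite -glue_restr kg// updbE.
    by congr (f (glue _ _)); apply/ffunP => i; rewrite !ffunE kk'.
  rewrite -IH mulr_sumr; apply: eq_bigr => z _.
  rewrite big_ord_recr/= glue_max mulrAC mulrC; congr (_ * (_ * _)).
  apply: eq_bigr => i _.
  by rewrite -[in RHS](glue_lift z b); congr (w _ (glue _ _ _));
    apply: val_inj; exact: (esym (lift_max i)).
by rewrite big_bool !E.
Qed.

Lemma le_witer_add (w : nat -> bool -> R) F F' k g g' c :
  (forall i b, (i < k)%N -> 0 <= w i b) ->
  (forall i, (i < k)%N -> w i true + w i false = 1) ->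
  (forall h h', (forall i, (i < k)%N -> h i = h' i) ->
     (forall i, (k <= i)%N -> h i = g i) -> (forall i, (k <= i)%N -> h' i = g' i) ->
     F h <= F' h' + c) ->
  witer w k F g <= witer w k F' g' + c.
Proof.
elim: k g g' => [|k IH] g g' w0 w1 H /=; first exact: H.
have E b : witer w k F (updb g k b) <= witer w k F' (updb g' k b) + c.
  apply: IH => [i b' ik|i ik|h h' hh' hg hg'].
  - by apply: w0; rewrite ltnW.
  - by apply: w1; rewrite ltnW.
  apply: H.
  - move=> i; rewrite ltnS leq_eqVlt => /predU1P[->|/hh'//].
    by rewrite hg// hg'// !updbE.
  - by move=> i ki; rewrite hg 1?ltnW// updb_neq// gtn_eqF.
  - by move=> i ki; rewrite hg' 1?ltnW// updb_neq// gtn_eqF.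
have := ler_wpM2l (w0 k true (ltnSn k)) (E true).
have := ler_wpM2l (w0 k false (ltnSn k)) (E false).
by have := w1 k (ltnSn k); nra.
Qed.

(** The Efron-Stein bound by induction: conditioning on the last coordinate, the variance is the
    mean of the conditional variances plus the variance of the conditional means. *)
Lemma witer_var (w : nat -> bool -> R) F k g (L : R) :
  (forall i b, (i < k)%N -> 0 <= w i b) ->
  (forall i, (i < k)%N -> w i true + w i false = 1) ->
  (forall i h, (i < k)%N -> `|F (updb h i true) - F (updb h i false)| <= 2 * L) ->
  witer w k (fun h => F h ^+ 2) g - witer w k F g ^+ 2 <= k%:R * L ^+ 2.
Proof.
elim: k g => [|k IH] g w0 w1 H /=; first by rewrite mul0r subrr.
have E b : witer w k (fun h => F h ^+ 2) (updb g k b) -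
    witer w k F (updb g k b) ^+ 2 <= k%:R * L ^+ 2.
  apply: IH => [i b' ik|i ik|i h ik].
  - by apply: w0; rewrite ltnW.
  - by apply: w1; rewrite ltnW.
  - by apply: H; rewrite ltnW.
have D b : witer w k F (updb g k b) <= witer w k F (updb g k (~~ b)) + 2 * L.
  apply: le_witer_add => [i b' ik|i ik|h h' hh' hg hg'].
  - by apply: w0; rewrite ltnW.
  - by apply: w1; rewrite ltnW.
  have upE c (h1 : nat -> bool) : h1 k = c -> (forall i, i != k -> h1 i = h i) -> h1 = updb h k c.
    move=> hk hi; apply/funext => i; rewrite /updb; case: eqP => [->//|/eqP ik].
    exact: hi.
  have -> : h = updb h k b by apply: upE => //; rewrite hg// updbE.
  have -> : h' = updb h k (~~ b).
    apply: upE; first by rewrite hg'// updbE.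
    move=> i ik; have [ltik|kleqi] := ltnP i k; first by rewrite hh'.
    by rewrite hg// hg'// !updb_neq.
  have := H k h (ltnSn k); rewrite ler_norml => /andP[h1 h2].
  rewrite -lerBlDl; case: b {E hg hg' upE} => //=.
  by rewrite -lerN2 opprB.
have E1 := E true; have E2 := E false; have D1 := D true; have D2 := D false.
move: E1 E2 D1 D2 => /=.
move: (witer w k F (updb g k true)) (witer w k F (updb g k false)).
move: (witer w k _ (updb g k true)) (witer w k _ (updb g k false)).
have := w0 k true (ltnSn k); have := w0 k false (ltnSn k); have := w1 k (ltnSn k).
move: (w k true) (w k false) => q q' qq' q0' q0 a b x y E1 E2 D1 D2.
have qE : q' = 1 - q by lra.
rewrite -natr1 mulrDl mul1r.
(* The variance of the two conditional means: they differ by at most [2 * L], and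
   [q * (1 - q) <= 1 / 4]. *)
have B : q * (1 - q) * (x - y) ^+ 2 <= L ^+ 2.
  have q4 : q * (1 - q) <= 1 / 4 by have := sqr_ge0 (q - 1 / 2); nra.
  have xy : (x - y) ^+ 2 <= 4 * L ^+ 2.
    have : 0 <= (2 * L - (x - y)) * (2 * L + (x - y)) by rewrite mulr_ge0//; lra.
    nra.
  have s0 : 0 <= (x - y) ^+ 2 by exact: sqr_ge0.
  have qq : 0 <= q * (1 - q) by rewrite mulr_ge0//; lra.
  nra.
have A1 := ler_wpM2l q0 E1; have A2 := ler_wpM2l q0' E2.
rewrite {}qE in A2 *.
have -> : q * a + (1 - q) * b - (q * x + (1 - q) * y) ^+ 2 =
  q * (a - x ^+ 2) + (1 - q) * (b - y ^+ 2) + q * (1 - q) * (x - y) ^+ 2 by ring.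
lra.
Qed.

Definition wext n (m : 'I_n -> bool -> R) (k : nat) (b : bool) : R :=
  if insub k is Some i then m i b else 0.

Lemma wextE n (m : 'I_n -> bool -> R) (i : 'I_n) b : wext m i b = m i b.
Proof. by rewrite /wext valK. Qed.

Lemma sum_prod_witer n (m : 'I_n -> bool -> R) (f : cube n -> R) g :
  \sum_(y : cube n) (\prod_(i < n) m i (y i)) * f y = witer (wext m) n (f \o restr n) g.
Proof.
rewrite -sum_cube_witer; apply: eq_bigr => y _; congr (_ * _).
by apply: eq_bigr => i _; rewrite wextE.
Qed.

Lemma sum_prod1 n (m : 'I_n -> bool -> R) : (forall i, m i true + m i false = 1) ->
  \sum_(y : cube n) \prod_(i < n) m i (y i) = 1.
Proof.
by move=> m1; rewrite -bigA_distr_bigA/= big1// => i _; rewrite big_bool /= m1.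
Qed.

Lemma sum_prod_marginal n (m : 'I_n -> bool -> R) (i : 'I_n) (h : bool -> R) :
  (forall i, m i true + m i false = 1) ->
  \sum_(y : cube n) (\prod_(j < n) m j (y j)) * h (y i) =
  m i true * h true + m i false * h false.
Proof.
move=> m1.
pose m' j b := m j b * (if j == i then h b else 1).
transitivity (\sum_(y : cube n) \prod_(j < n) m' j (y j)).
  apply: eq_bigr => y _; rewrite /m' big_split/=; congr (_ * _).
  by rewrite (bigD1 i)//= eqxx big1 ?mulr1// => j /negbTE ->.
rewrite -bigA_distr_bigA/= (bigD1 i)//= big_bool /m' /= eqxx [X in _ * X]big1 ?mulr1//.
by move=> j /negbTE ->; rewrite big_bool /= !mulr1 m1.
Qed.

Lemma setc_restr n (g : nat -> bool) (i : 'I_n) b :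
  setc (restr n g) i b = restr n (updb g i b).
Proof. by apply/ffunP => j; rewrite !ffunE /updb. Qed.

Lemma dpart_le_Lip n (f : cube n -> R) i y : `|dpart f i y| <= Lip f.
Proof.
by apply: le_trans (le_bigmax _ _ i); exact: le_bigmax.
Qed.

Lemma Lip_ge0 n (f : cube n -> R) : 0 <= Lip f.
Proof. exact: bigmax_ge_id. Qed.

Lemma product_variance n (m : 'I_n -> bool -> R) (f : cube n -> R) :
  (forall i b, 0 <= m i b) -> (forall i, m i true + m i false = 1) ->
  forall E, \sum_(y : cube n) (\prod_(i < n) m i (y i)) * f y = E ->
  \sum_(y : cube n) (\prod_(i < n) m i (y i)) * (f y - E) ^+ 2 <= n%:R * Lip f ^+ 2.
Proof.
move=> m0 m1 E EE; pose xi (y : cube n) := \prod_(i < n) m i (y i).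
rewrite (_ : \sum_y _ = \sum_y xi y * f y ^+ 2 - E ^+ 2); last first.
  transitivity (\sum_y (xi y * f y ^+ 2 + (- (2 * E) * (xi y * f y) + E ^+ 2 * xi y))).
    by apply: eq_bigr => y _; rewrite -/(xi y); ring.
  rewrite !big_split/= -!mulr_sumr EE (sum_prod1 m1); ring.
rewrite -EE /xi (sum_prod_witer m (fun y => f y ^+ 2) (fun=> true)).
rewrite (sum_prod_witer m f (fun=> true)).
apply: (@witer_var _ (f \o restr n)).
- by move=> i b ik; rewrite (wextE m (Ordinal ik)).
- by move=> i ik; rewrite !(wextE m (Ordinal ik)).
move=> i h ik; have := dpart_le_Lip f (Ordinal ik) (restr n h).
rewrite /dpart !setc_restr/= normrM [X in _ * X]ger0_norm; last by rewrite invr_ge0.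
by rewrite ler_pdivrMr// mulrC.
Qed.

Lemma mu_pE n (p : R) (y : cube n) : mu_p p y = \prod_(i < n) pweight p i (y i).
Proof.
rewrite /mu_p -exprVn -[n in _ ^+ n]card_ord -prodr_const -big_split/=.
apply: eq_bigr => i _; rewrite /pweight /spin; case: (y i); lra.
Qed.

Lemma mu_p_gt0 n (p : R) (y : cube n) : 0 < p < 1 -> 0 < mu_p p y.
Proof.
move=> /andP[p0 p1]; rewrite mu_pE prodr_gt0// => i _.
by rewrite /pweight; case: (y i); rewrite ?subr_gt0.
Qed.

Lemma sum_mu_p n (p : R) : \sum_(y : cube n) mu_p p y = 1.
Proof.
under eq_bigr do rewrite mu_pE.
by apply: (@sum_prod1 n (fun i => pweight p i)) => i; rewrite /pweight subrKC.
Qed.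

(** The variational lower bound for relative entropy; it follows from [1 + u <= exp u] at
    [u = h - ln Z - ln (xi / mu_p)], weighted by [xi]. *)
Lemma gibbs n (p : R) (xi h : cube n -> R) : 0 < p < 1 ->
  (forall y, 0 <= xi y) -> \sum_y xi y = 1 ->
  \sum_y xi y * h y - ln (\sum_y mu_p p y * expR (h y)) <= KL p xi.
Proof.
move=> p01 xi0 xi1; set Z := (X in ln X).
have mu0 y := @mu_p_gt0 n p y p01.
have Z0 : 0 < Z.
  rewrite /Z (bigD1 [ffun=> true])//; apply: ltr_pwDl.
    by rewrite mulr_gt0 ?expR_gt0.
  by rewrite sumr_ge0// => y _; rewrite mulr_ge0 ?expR_ge0// ltW.
(* The added terms have total 0, both families being of mass 1; with them the inequality holds term
   by term, also where [xi] vanishes. *)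
have -> : \sum_y xi y * h y - ln Z = \sum_y ((xi y * h y - ln Z * xi y) +
    (xi y - mu_p p y * expR (h y) / Z)).
  rewrite big_split/= !sumrB -mulr_sumr -mulr_suml xi1 -/Z mulr1.
  by rewrite divff ?gt_eqF// subrr addr0.
apply: ler_sum => y _.
have := xi0 y; rewrite le_eqVlt => /predU1P[<-|xiy].
  rewrite !(mul0r, mulr0) subrr !add0r oppr_le0.
  by apply: divr_ge0; [apply: mulr_ge0; [exact: ltW|exact: expR_ge0]|exact: ltW].
have r0 : 0 < xi y / mu_p p y by rewrite divr_gt0.
have := expR_ge1Dx (h y - ln Z - ln (xi y / mu_p p y)).
rewrite !expRD !expRN !lnK ?posrE// => H.
have := ler_wpM2l (ltW xiy) H.
have -> : xi y * (expR (h y) / Z / (xi y / mu_p p y)) = mu_p p y * expR (h y) / Z.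
  by field; rewrite !gt_eqF.
lra.
Qed.

Lemma KL_ge0 n (p : R) (xi : cube n -> R) : 0 < p < 1 ->
  (forall y, 0 <= xi y) -> \sum_y xi y = 1 -> 0 <= KL p xi.
Proof.
move=> p01 xi0 xi1; have := gibbs (fun=> 0) p01 xi0 xi1.
rewrite expR0; under eq_bigr do rewrite mulr0.
under [X in ln X]eq_bigr do rewrite mulr1.
by rewrite sum_mu_p ln1 subr0 big1.
Qed.

(** Chebyshev's inequality with [product_variance] gives the event [xi]-mass at least [1 - eta]; the
    Gibbs bound then converts this mass and [KL p xi] into a lower bound on the
    [mu_p]-probability. *)
Lemma ln_prob_ge_lower n (p t delta : R) (f xi : cube n -> R) :
  (0 < n)%N -> 0 < p < 1 -> 0 < delta -> is_product_pm xi ->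
  t * n%:R <= \sum_y f y * xi y ->
  (n%:R * delta ^+ 2)^-1 * Lip f ^+ 2 <= 1 / 2 ->
  0 < prob_ge p f ((t - delta) * n%:R) /\
  - KL p xi * (1 + 2 / (n%:R * delta ^+ 2) * Lip f ^+ 2) - 2
    <= ln (prob_ge p f ((t - delta) * n%:R)).
Proof.
move=> n0 p01 d0 [m [m0 [m1 xiE]]] tn; set eta := _^-1 * _ => eta2.
have nR : 0 < n%:R :> R by rewrite ltr0n.
have xi0 y : 0 <= xi y by rewrite xiE prodr_ge0.
have xi1 : \sum_y xi y = 1 by under eq_bigr do rewrite xiE; exact: sum_prod1.
set s0 := (t - delta) * n%:R.
pose E := \sum_y xi y * f y.
have Et : t * n%:R <= E by apply: le_trans tn _; rewrite /E; under eq_bigr do rewrite mulrC.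
have var : \sum_y xi y * (f y - E) ^+ 2 <= n%:R * Lip f ^+ 2.
  under eq_bigr do rewrite xiE.
  by apply: product_variance => //; apply: eq_bigr => y _; rewrite xiE.
have eta0 : 0 <= eta by rewrite mulr_ge0 ?sqr_ge0// invr_ge0 mulr_ge0 ?sqr_ge0// ltW.
have cheb : \sum_(y | ~~ (s0 <= f y)) xi y <= eta.
  have dn0 : 0 < (delta * n%:R) ^+ 2 by rewrite exprn_gt0// mulr_gt0.
  rewrite -(ler_pM2l dn0) mulr_sumr.
  have -> : (delta * n%:R) ^+ 2 * eta = n%:R * Lip f ^+ 2.
    by rewrite /eta; field; rewrite !gt_eqF.
  apply: le_trans var; rewrite [leRHS](bigID (fun y => s0 <= f y))/= ler_wpDl//.
    by apply: sumr_ge0 => y _; rewrite mulr_ge0// sqr_ge0.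
  apply: ler_sum => y; rewrite -ltNge => fy; rewrite mulrC ler_wpM2l//.
  rewrite -[leRHS]sqrrN ler_sqr ?nnegrE ?opprB.
  - move: fy Et; rewrite /s0; lra.
  - by rewrite mulr_ge0 ?ltW.
  - move: fy Et (mulr_gt0 d0 nR); rewrite /s0; lra.
pose b := \sum_(y | s0 <= f y) xi y.
have bE : 1 - eta <= b.
  by have := xi1; rewrite (bigID (fun y => s0 <= f y))/= -/b; move: cheb; lra.
set a := prob_ge _ _ _.
have mu0 y := @mu_p_gt0 n p y p01.
have a0 : 0 < a.
  have : b != 0 by rewrite gt_eqF//; lra.
  rewrite psumr_neq0// => /hasP[y _ /andP[fy _]].
  rewrite /a /prob_ge (bigD1 y)//= ltr_wpDr// sumr_ge0// => z _; exact: ltW.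
split => //.
have a1 : a <= 1.
  rewrite -(sum_mu_p n p) [leRHS](bigID (fun y => s0 <= f y))/= lerDl.
  by apply: sumr_ge0 => y _; exact: ltW.
have la : ln a <= 0 by rewrite -ln1 ler_ln ?posrE.
(* With [a] the probability of the event, the test function [- ln a] on it has exponential moment
   [1 + (1 - a)], whose logarithm is at most 1. *)
have := gibbs (fun y => if s0 <= f y then - ln a else 0) p01 xi0 xi1.
have -> : \sum_y xi y * (if s0 <= f y then - ln a else 0) = b * - ln a.
  rewrite /b mulr_suml [RHS]big_mkcond; apply: eq_bigr => y _.
  by case: ifP; rewrite ?mulr0.
have -> : \sum_y mu_p p y * expR (if s0 <= f y then - ln a else 0) = 2 - a.
  have -> : 2 - a = a * a^-1 + (\sum_(y : cube n) mu_p p y - a).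
    by rewrite mulfV ?gt_eqF// sum_mu_p; ring.
  rewrite (bigID (fun y => s0 <= f y))/= [in RHS](bigID (fun y => s0 <= f y))/=.
  congr (_ + _).
    rewrite {1}/a /prob_ge mulr_suml; apply: eq_bigr => y ->.
    by rewrite expRN lnK.
  rewrite /a /prob_ge addrAC subrr add0r.
  by apply: eq_bigr => y /negbTE ->; rewrite expR0 mulr1.
move=> H.
have l2 : ln (2 - a) <= 1.
  have e1 : ln (expR 1) = 1 :> R by rewrite expRK.
  rewrite -[leRHS]e1 ler_ln ?posrE ?expR_gt0//; last by lra.
  by have := expR_ge1Dx (1 : R); lra.
have kl := KL_ge0 p01 xi0 xi1.
have -> : 2 / (n%:R * delta ^+ 2) * Lip f ^+ 2 = 2 * eta by rewrite /eta; ring.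
have h1 : (1 - eta) * - ln a <= KL p xi + 1.
  have := ler_wpM2r (_ : 0 <= - ln a) bE; rewrite oppr_ge0 => /(_ la); lra.
have e2 : 0 <= 1 + 2 * eta by lra.
have := ler_wpM2r e2 h1.
(* The product is [1 + eta * (1 - 2 * eta)], and [eta <= 1 / 2]. The additive error 1 of [h1]
   becomes [1 + 2 * eta <= 2], whence the final constant. *)
have e3 : 1 <= (1 - eta) * (1 + 2 * eta) by nra.
have := ler_wpM2r (_ : 0 <= - ln a) e3; rewrite oppr_ge0 => /(_ la).
nra.
Qed.

End cube_sums.

(** * The variational problem on the hull of the gradients *)

Section paths.
Variable R : realType.

Lemma witerB (w : nat -> bool -> R) F F' k g :
  witer w k (fun h => F h - F' h) g = witer w k F g - witer w k F' g.
Proof. by elim: k g => [//|k IH] g /=; rewrite !IH; ring. Qed.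

(** Since the direction [be] has total 0 in each coordinate, varying the weights of coordinate [i]
    produces [be i true] times the mean of the discrete difference there. The product rule at the
    last coordinate gives the induction. *)
Lemma is_derive_witer (al be : nat -> bool -> R) F k g (s : R) :
  (forall i, (i < k)%N -> al i true + al i false = 1) ->
  (forall i, (i < k)%N -> be i false = - be i true) ->
  is_derive s 1 (fun s : R => witer (fun i b => al i b + s * be i b) k F g)
   (\sum_(i < k) be i true * witer (fun i b => al i b + s * be i b) k
      (fun h => F (updb h i true) - F (updb h i false)) g).
Proof.
elim: k g => [|k IH] g al1 be0 /=.
  by rewrite big_ord0; exact: is_derive_cst.
set w := fun s i b => al i b + s * be i b.
have dw b : is_derive s 1 (fun s : R => w s k b) (be k b).
  have -> : (fun s : R => w s k b) = cst (al k b) + id * cst (be k b) by [].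
  apply: is_derive_eq.
  by rewrite add0r scaler0 add0r /cst /GRing.scale/= mulr1.
pose D i (h : nat -> bool) := F (updb h i true) - F (updb h i false).
have IHb b : is_derive s 1 (fun s : R => witer (w s) k F (updb g k b))
    (\sum_(i < k) be i true * witer (w s) k (D i) (updb g k b)).
  by apply: IH => i ik; [exact: al1 (ltnW ik)|exact: be0 (ltnW ik)].
have -> : (fun s : R => w s k true * witer (w s) k F (updb g k true) +
     w s k false * witer (w s) k F (updb g k false)) =
   (fun s => w s k true) * (fun s => witer (w s) k F (updb g k true)) +
   (fun s => w s k false) * (fun s => witer (w s) k F (updb g k false)) by [].
apply: is_derive_eq.
rewrite big_ord_recr/= /GRing.scale/=.
have Dk b : witer (w s) k (D k) (updb g k b) =
    witer (w s) k F (updb g k true) - witer (w s) k F (updb g k false).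
  have E c : witer (w s) k (fun h => F (updb h k c)) (updb g k b) =
      witer (w s) k F (updb g k c).
    apply: eq_witer => h h' hh' hg hg'; congr F; apply/funext => i.
    rewrite /updb; case: eqP => [->|/eqP ik]; first by rewrite hg'// updbE.
    have [/hh'//|ki] := ltnP i k; by rewrite hg// hg'// !updb_neq.
  by rewrite witerB !E.
rewrite -/(D k) !Dk -!/(w _ _ _) (be0 k)//.
under [X in _ = X + _]eq_bigr do rewrite mulrDr !(mulrCA (be _ _)).
rewrite big_split/= -!mulr_sumr.
have -> : w s k false = 1 - w s k true.
  by rewrite /w (be0 k)//; have := al1 k (ltnSn k); lra.
by rewrite -/D; ring.
Qed.

End paths.

(** * Tilted product measures and maximization over a simplex *)

Section tilting.
Variable R : realType.
Local Notation spin := (@spin R).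

Definition tilt (p v : R) (b : bool) : R :=
  (if b then p else 1 - p) * expR (v * spin b - log_laplace p v).

Definition tilt_mean (p v : R) : R := tilt p v true - tilt p v false.

Lemma tilt_ge0 (p v : R) b : 0 < p < 1 -> 0 <= tilt p v b.
Proof.
by move=> /andP[p0 p1]; rewrite /tilt mulr_ge0 ?expR_ge0//; case: b; lra.
Qed.

Lemma tilt_sum (p v : R) : 0 < p < 1 -> tilt p v true + tilt p v false = 1.
Proof.
move=> p01; rewrite /tilt /spin mulr1 mulrN1 !expRD !expRN expR_log_laplace// expRN !mulrA.
by rewrite -mulrDl mulfV// -expRN gt_eqF// two_point_laplace_gt0.
Qed.

Lemma expR_le_quadratic (b : R) : `|b| <= 1 / 2 -> expR b <= 1 + b + 2 * b ^+ 2.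
Proof.
rewrite ler_norml => /andP[b1 b2].
have h : 1 - b <= (expR b)^-1 by rewrite -expRN; exact: expR_ge1Dx.
have e0 := expR_gt0 b.
have : expR b * (1 - b) <= 1 by rewrite -[leRHS](mulfV (lt0r_neq0 e0)) ler_pM2l.
have : 1 <= (1 + b + 2 * b ^+ 2) * (1 - b).
  have : 0 <= b ^+ 2 * (1 - 2 * b) by rewrite mulr_ge0 ?sqr_ge0//; lra.
  nra.
move=> h1 h2; rewrite -(@ler_pM2r _ (1 - b)); last by lra.
exact: le_trans h2 h1.
Qed.

(** [tilt_mean] is the derivative of [log_laplace]; this one-sided expansion replaces
    differentiation. The increment is the logarithm of the tilted mean of [exp (b * spin)], and
    [1 + ln X <= X]. *)
Lemma log_laplace_le_quadratic (p v b : R) : 0 < p < 1 -> `|b| <= 1 / 2 ->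
  log_laplace p (v + b) <= log_laplace p v + tilt_mean p v * b + 2 * b ^+ 2.
Proof.
move=> p01 b12; have T1 := tilt_sum v p01.
have nb : `|- b| <= 1 / 2 by rewrite normrN.
have e1 := expR_le_quadratic b12; have := expR_le_quadratic nb; rewrite sqrrN => e2.
have t0 := tilt_ge0 v true p01; have t1 := tilt_ge0 v false p01.
pose X := tilt p v true * expR b + tilt p v false * expR (- b).
have XE : expR (log_laplace p (v + b) - log_laplace p v) = X.
  rewrite expRD expR_log_laplace// /X /tilt /spin mulr1 mulrN1 opprD !expRD; ring.
have := expR_ge1Dx (log_laplace p (v + b) - log_laplace p v); rewrite XE.
have A1 := ler_wpM2l t0 e1; have A2 := ler_wpM2l t1 e2.
by rewrite /tilt_mean /X; move: T1 A1 A2; nra.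
Qed.

Lemma continuous_log_laplace (p : R) : 0 < p < 1 -> continuous (log_laplace p).
Proof.
move=> p01 v; apply: (@continuous_comp _ _ _ (fun v => p * expR v + (1 - p) * expR (- v)) (@ln R)).
  apply: cvgD; apply: cvgM; [exact: cvg_cst|exact: continuous_expR|exact: cvg_cst|].
  by apply: (@continuous_comp _ _ _ -%R (@expR R)); [exact: opp_continuous|exact: continuous_expR].
exact/continuous_ln/two_point_laplace_gt0.
Qed.

(** The log-density with respect to [mu_p] is a sum over coordinates, so only the one-coordinate
    marginals enter its mean. *)
Lemma KL_tilt n (p : R) (V : 'I_n -> R) : 0 < p < 1 ->
  KL p (fun y : cube n => \prod_(i < n) tilt p (V i) (y i)) =
  \sum_(i < n) (tilt_mean p (V i) * V i - log_laplace p (V i)).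
Proof.
move=> p01; have T1 i := tilt_sum (V i) p01.
transitivity (\sum_(y : cube n) \sum_(i < n) (\prod_(j < n) tilt p (V j) (y j)) *
    (V i * spin (y i) - log_laplace p (V i))).
  apply: eq_bigr => y _; rewrite -mulr_sumr; congr (_ * _).
  rewrite -[RHS]expRK expR_sum mu_pE; congr ln.
  rewrite /tilt big_split/= mulrAC mulfV ?mul1r//.
  by rewrite -[X in X != 0](mu_pE p y) gt_eqF// mu_p_gt0.
rewrite exchange_big/=; apply: eq_bigr => i _.
have := @sum_prod_marginal _ n (fun j => tilt p (V j)) i
  (fun b => V i * spin b - log_laplace p (V i)) T1.
move=> /= ->; rewrite /tilt_mean /spin.
have -> : tilt p (V i) false = 1 - tilt p (V i) true by have := T1 i; lra.
ring.
Qed.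

Lemma le0_of_quadratic (x B K : R) : 0 <= B -> 0 <= K ->
  (forall tau, 0 < tau -> tau <= 1 -> tau * B <= 1 / 2 -> x <= tau * K) -> x <= 0.
Proof.
move=> B0 K0 H; rewrite leNgt; apply/negP => x0.
(* Chosen so that [tau = x / d] is admissible and [tau * K <= x / 2], a contradiction when
   [x > 0]. *)
pose d := x * (1 + 2 * B) + 2 * K.
have d0 : 0 < d by rewrite ltr_pwDl ?mulr_ge0// mulr_gt0//; lra.
have h1 : x / d <= 1 by rewrite ler_pdivrMr// mul1r /d; nra.
have h2 : x / d * B <= 1 / 2.
  by rewrite mulrAC ler_pdivrMr// /d; nra.
have := H _ (divr_gt0 x0 d0) h1 h2; rewrite mulrAC ler_pdivlMr// /d; nra.
Qed.

Lemma continuous_sum (T : topologicalType) (I : finType) (F : I -> T -> R) :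
  (forall i, continuous (F i)) -> continuous (fun x => \sum_i F i x).
Proof. by move=> cF; apply: continuous_big => //; exact: add_continuous. Qed.

Lemma continuous_Mc (T : topologicalType) (h : T -> R) (c : R) :
  continuous h -> continuous (fun x => h x * c).
Proof. by move=> ch x; apply: cvgM; [exact: ch|exact: cvg_cst]. Qed.

Lemma continuous_cM (T : topologicalType) (h : T -> R) (c : R) :
  continuous h -> continuous (fun x => c * h x).
Proof. by move=> ch x; apply: cvgM; [exact: cvg_cst|exact: ch]. Qed.

Lemma continuous_sub (T : topologicalType) (h k : T -> R) :
  continuous h -> continuous k -> continuous (fun x => h x - k x).
Proof. by move=> ch ck x; apply: cvgB; [exact: ch|exact: ck]. Qed.

Lemma continuous_log_laplace_comp (T : topologicalType) (h : T -> R) (p : R) : 0 < p < 1 ->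
  continuous h -> continuous (fun x => log_laplace p (h x)).
Proof.
move=> p01 ch x; apply: (@continuous_comp _ _ _ h (log_laplace p)); first exact: ch.
exact: continuous_log_laplace.
Qed.

(** Compactness, after moving to row vectors. Total mass at most 1 is allowed because the missing
    mass sits at the vertex 0 of the hull. *)
Lemma exists_max_subprobability (I : finType) (Th : (I -> R) -> R) :
  continuous (fun v : 'rV[R]_#|I| => Th (fun z => v ord0 (enum_rank z))) ->
  exists c : I -> R, [/\ forall z, 0 <= c z, \sum_z c z <= 1 &
    forall c', (forall z, 0 <= c' z) -> \sum_z c' z <= 1 -> Th c' <= Th c].
Proof.
move=> cTh; pose A := [set v : 'rV[R]_#|I| | forall i, v ord0 i \in `[0, 1]]
   `&` [set v : 'rV[R]_#|I| | \sum_z v ord0 (enum_rank z) <= 1].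
have cA : compact A.
  apply: compact_closedI.
    by apply: (@rV_compact R _ (fun=> `[0, 1]%classic)) => _; exact: segment_compact.
  apply: (@preimage_closed _ _ (fun v : 'rV[R]_#|I| => \sum_z v ord0 (enum_rank z))
    [set x | x <= 1]); last exact: closed_le.
  by move=> v _; apply: continuous_sum => z; exact: coord_continuous.
have A0 : A !=set0.
  exists 0; split => [i|]/=; first by rewrite mxE in_itv/= lexx ler01.
  by rewrite big1 ?ler01// => z _; rewrite mxE.
have [v /set_mem[v01 v1] vmax] := EVT_max_rV A0 cA (continuous_subspaceT cTh).
exists (fun z => v ord0 (enum_rank z)); split => //.
  by move=> z; have := v01 (enum_rank z); rewrite /= in_itv/= => /andP[].
move=> c' c0 c1; pose v' : 'rV[R]_#|I| := \row_i c' (enum_val i).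
have v'E : (fun z => v' ord0 (enum_rank z)) = c'.
  by apply/funext => z; rewrite mxE enum_rankK.
have := vmax v'; rewrite v'E; apply; apply/mem_set; split => /=.
  move=> i; rewrite mxE in_itv/= c0/= (le_trans _ c1)// (bigD1 (enum_val i))//=.
  by rewrite lerDl sumr_ge0.
by under eq_bigr do rewrite mxE enum_rankK.
Qed.

End tilting.

(** * Optimality conditions on the hull of the gradients *)

Section mean_field_direction.
Variable R : realType.
Local Notation spin := (@spin R).

(** The weights move linearly from [m] to the point mass at [y]. The derivative of the mean of [f]
    is a mean of [<grad f(z), y - E_m>], with [E_m] the mean vector of [m]; by the mean value
    theorem it exceeds [a] at some time, hence so does one of the averaged terms. *)
Lemma path_increment n (m : 'I_n -> bool -> R) (f : cube n -> R) (y : cube n) (a : R) :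
  (forall i b, 0 <= m i b) -> (forall i, m i true + m i false = 1) ->
  a < f y - \sum_(z : cube n) (\prod_(i < n) m i (z i)) * f z ->
  exists z, a < \sum_(i < n) dpart f i z * (spin (y i) - (m i true - m i false)).
Proof.
move=> m0 m1 af.
pose e i b : R := (b == y i)%:R - m i b.
pose w (s : R) i b := m i b + s * e i b.
have e0 i : e i false = - e i true.
  by rewrite /e; have := m1 i; case: (y i) => /=; lra.
pose F := f \o restr n.
pose phi s := \sum_(z : cube n) (\prod_(i < n) w s i (z i)) * f z.
pose G z := \sum_(i < n) dpart f i z * (spin (y i) - (m i true - m i false)).
have phiE s : phi s = witer (fun i b => wext m i b + s * wext e i b) n F (fun=> true).
  rewrite /F -sum_cube_witer; apply: eq_bigr => z _; congr (_ * _).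
  by apply: eq_bigr => i _; rewrite !wextE.
have dphi (s : R) : is_derive s 1 phi (\sum_(z : cube n) (\prod_(i < n) w s i (z i)) * G z).
  have -> : phi = fun s => witer (fun i b => wext m i b + s * wext e i b) n F (fun=> true).
    by apply/funext.
  apply: is_derive_eq.
    apply: is_derive_witer => i ik; [by rewrite !(wextE m (Ordinal ik))|].
    by rewrite !(wextE e (Ordinal ik)).
  under [RHS]eq_bigr do rewrite mulr_sumr.
  rewrite [RHS]exchange_big/=; apply: eq_bigr => i _.
  rewrite (_ : witer _ _ _ _ = \sum_(z : cube n) (\prod_(i < n) w s i (z i)) *
      (f (setc z i true) - f (setc z i false))).
    rewrite wextE mulr_sumr; apply: eq_bigr => z _; rewrite mulrCA; congr (_ * _).
    (* This factor 1/2 is matched by the one in [dpart]. *)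
    have -> : e i true = (spin (y i) - (m i true - m i false)) / 2.
      by rewrite /e /spin; have := m1 i; case: (y i) => /=; lra.
    by rewrite /dpart; ring.
  rewrite (_ : (fun h => _) = (fun z => f (setc z i true) - f (setc z i false)) \o restr n).
    rewrite -sum_cube_witer; apply: eq_bigr => z _; congr (_ * _).
    by apply: eq_bigr => j _; rewrite !wextE.
  by apply/funext => h /=; rewrite !setc_restr.
have phi0 : phi 0 = \sum_(z : cube n) (\prod_(i < n) m i (z i)) * f z.
  apply: eq_bigr => z _; congr (_ * _); apply: eq_bigr => i _.
  by rewrite /w mul0r addr0.
have phi1 : phi 1 = f y.
  rewrite /phi (bigD1 y)//= big1 ?mul1r => [|i _]; last by rewrite /w /e eqxx mul1r subrKC.
  rewrite big1 ?addr0// => z zy.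
  have [i /negbTE zi] : exists i, z i != y i.
    apply/existsP; rewrite -negb_forall; apply: contra zy => /forallP zy.
    by apply/eqP/ffunP => i; exact/eqP.
  by rewrite (bigD1 i)//= /w /e zi mul1r sub0r subrr !mul0r.
have cphi : {within `[0, 1], continuous phi}.
  apply: derivable_within_continuous => s _; exact: (@ex_derive _ _ _ _ _ _ _ (dphi s)).
have [c] := MVT ltr01 (fun s _ => dphi s) cphi.
rewrite in_itv/= => /andP[c0 c1]; rewrite subr0 mulr1 phi0 phi1 => E.
rewrite {}E in af.
apply: contrapT => /forallNP H.
have : \sum_(z : cube n) (\prod_(i < n) w c i (z i)) * G z <= a.
  rewrite (@le_trans _ _ (\sum_(z : cube n) (\prod_(i < n) w c i (z i)) * a))//.
    apply: ler_sum => z _; rewrite ler_wpM2l//; last by rewrite leNgt; apply/negP/H.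
    (* At an intermediate time the weights are convex combinations of [m] and a point mass, hence a
       probability. *)
    apply: prodr_ge0 => i _; rewrite /w /e.
    have -> : m i (z i) + c * ((z i == y i)%:R - m i (z i)) =
       (1 - c) * m i (z i) + c * (z i == y i)%:R by ring.
    by rewrite addr_ge0// mulr_ge0// ?subr_ge0 ltW.
  rewrite -mulr_suml (@sum_prod1 _ _ (w c)) ?mul1r// => i.
  by rewrite /w e0; have := m1 i; lra.
by rewrite leNgt af.
Qed.

(** The coefficients [c] parametrize the hull [K]. The intended values are [s = (t - delta) n],
    [a = delta n] and [lam = M / a]. *)
Lemma mean_field_direction n (f : cube n -> R) (y : cube n) (p s a M lam : R) :
  0 < p < 1 -> 0 <= lam -> M <= lam * a -> s + a <= f y ->
  (forall xi, is_product_pm xi -> s <= \sum_z f z * xi z -> M <= KL p xi) ->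
  exists c : cube n -> R, [/\ forall z, 0 <= c z, \sum_z c z <= 1 &
    M <= \sum_(i < n) ((lam * \sum_z c z * dpart f i z) * spin (y i) -
                       log_laplace p (lam * \sum_z c z * dpart f i z))].
Proof.
move=> p01 lam0 Ma sy HM.
pose V (c : cube n -> R) i := lam * \sum_z c z * dpart f i z.
pose Th c := \sum_(i < n) (V c i * spin (y i) - log_laplace p (V c i)).
have cTh : continuous (fun v : 'rV[R]_#|{: cube n}| => Th (fun z => v ord0 (enum_rank z))).
  have cV i : continuous (fun v : 'rV[R]_#|{: cube n}| => V (fun z => v ord0 (enum_rank z)) i).
    apply: continuous_cM; apply: continuous_sum => z; apply: continuous_Mc.
    exact: coord_continuous.
  apply: continuous_sum => i; apply: continuous_sub; first by apply: continuous_Mc.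
  exact: continuous_log_laplace_comp.
have [c [c0 c1 cmax]] := exists_max_subprobability cTh.
exists c; split => //; rewrite -/(Th c).
pose m i := tilt_mean p (V c i).
(* The maximizer is compared with [(1 - tau) c + tau c']; the quadratic bound on [log_laplace]
   leaves an error of order [tau^2], and [le0_of_quadratic] lets [tau] be small. *)
have first_order c' : (forall z, 0 <= c' z) -> \sum_z c' z <= 1 ->
    \sum_(i < n) (V c' i - V c i) * (spin (y i) - m i) <= 0.
  move=> c'0 c'1; pose d i := V c' i - V c i.
  apply: (@le0_of_quadratic _ _ (\sum_i `|d i|) (2 * \sum_i d i ^+ 2)).
  - exact: sumr_ge0.
  - by rewrite mulr_ge0// sumr_ge0// => i _; exact: sqr_ge0.
  move=> tau t0 t1 tB.
  pose ct z := (1 - tau) * c z + tau * c' z.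
  have VE i : V ct i = V c i + tau * d i.
    rewrite /V /ct; under eq_bigr do rewrite mulrDl -!mulrA.
    by rewrite big_split/= -!mulr_sumr /d /V; ring.
  have := cmax ct; have ct0 z : 0 <= ct z.
    by rewrite addr_ge0// mulr_ge0// ?subr_ge0// ltW.
  have ct1 : \sum_z ct z <= 1.
    rewrite big_split/= -!mulr_sumr.
    have h : 0 <= 1 - tau by rewrite subr_ge0.
    by have := ler_wpM2l h c1; have := ler_wpM2l (ltW t0) c'1; lra.
  move=> /(_ ct0 ct1).
  rewrite -subr_ge0 -sumrB => H.
  have : \sum_(i < n) (tau * (d i * (spin (y i) - m i)) - tau ^+ 2 * (2 * d i ^+ 2)) <= 0.
    rewrite -oppr_ge0 -sumrN (le_trans H)//; apply: ler_sum => i _.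
    have db : `|tau * d i| <= 1 / 2.
      rewrite normrM (gtr0_norm t0) (le_trans _ tB)// (ler_wpM2l (ltW t0))//.
      by rewrite (bigD1 i)//= lerDl sumr_ge0.
    have := log_laplace_le_quadratic (V c i) p01 db.
    by rewrite VE -/(m i); nra.
  rewrite sumrB -!mulr_sumr subr_le0 expr2 -mulrA ler_pM2l//.
pose xi (z : cube n) := \prod_(i < n) tilt p (V c i) (z i).
have m0 i b : 0 <= tilt p (V c i) b by exact: tilt_ge0.
have m1 i : tilt p (V c i) true + tilt p (V c i) false = 1 by exact: tilt_sum.
have xiP : is_product_pm xi by exists (fun i => tilt p (V c i)).
have ThE : Th c = \sum_(i < n) V c i * (spin (y i) - m i) + KL p xi.
  by rewrite KL_tilt// -big_split/=; apply: eq_bigr => i _; rewrite -/(m i); ring.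
rewrite ThE.
(* If [xi] is admissible, optimality is tested against the point 0; otherwise against the vertex
   [lam * grad f(z)] supplied by [path_increment]. *)
have [sE|sE] := leP s (\sum_z f z * xi z).
  have c00 (z : cube n) : 0 <= (0 : R) by [].
  have := first_order (fun=> 0) c00.
  rewrite big1// => /(_ ler01).
  have V0 i : V (fun=> 0) i = 0 by rewrite /V big1 ?mulr0// => z _; rewrite mul0r.
  under eq_bigr do rewrite V0 sub0r mulNr.
  rewrite sumrN oppr_le0 => h; rewrite (le_trans (HM _ xiP sE))// lerDr//.
have kl0 : 0 <= KL p xi.
  by apply: KL_ge0 => // [z|]; [rewrite prodr_ge0|exact: (@sum_prod1 _ n (fun i => tilt p (V c i)))].
have [] := @path_increment n _ f y a m0 m1.
  rewrite ltrBrDl; apply: lt_le_trans sy; rewrite ltrD2r.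
  by under eq_bigr do rewrite mulrC.
move=> z az.
have d0 z' : 0 <= (z' == z)%:R :> R by [].
have d1 : \sum_(z' : cube n) (z' == z)%:R <= 1 :> R.
  by rewrite (bigD1 z)//= eqxx big1 ?addr0// => z' /negbTE ->.
have := first_order (fun z' => (z' == z)%:R) d0 d1.
have VE i : V (fun z' => (z' == z)%:R) i = lam * dpart f i z.
  rewrite /V (bigD1 z)//= eqxx mul1r big1 ?addr0// => z' /negbTE ->.
  by rewrite mul0r.
under eq_bigr do rewrite VE mulrBl -mulrA.
rewrite sumrB -mulr_sumr subr_le0 => h.
rewrite (le_trans Ma)// (le_trans (ler_wpM2l lam0 (ltW az)))//.
by rewrite (le_trans h)// lerDl.
Qed.

End mean_field_direction.

(** * The two bounds *)

Section complexity.
Variable R : realType.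
Local Notation kap := (@gauss_abs R).
Local Notation spin := (@spin R).

Definition oext n (h : 'I_n -> R) (k : nat) : R := oapp h 0 (insub k).

Lemma oextE n (h : 'I_n -> R) (i : 'I_n) : oext h i = h i.
Proof. by rewrite /oext valK. Qed.

Definition grad_sup n (f : cube n -> R) (G : nat -> R) : R :=
  pos_max (fun z => \sum_(i < n) dpart f i z * G i).

Definition grad_norm1 n (f : cube n -> R) : R :=
  \sum_(z : cube n) \sum_(i < n) `|oext (dpart f ^~ z) i|.

Lemma grad_norm1_ge0 n (f : cube n -> R) : 0 <= grad_norm1 f.
Proof. exact: (sum_norm_ge0 (fun z => oext (dpart f ^~ z))). Qed.

Lemma l1_lipschitz_grad_sup n (f : cube n -> R) : l1_lipschitz (grad_norm1 f) n (grad_sup f).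
Proof.
have -> : grad_sup f = fun G => pos_max (fun z => 0 + \sum_(i < n) oext (dpart f ^~ z) i * G i).
  apply/funext => G; congr pos_max; apply/funext => z; rewrite add0r.
  by apply: eq_bigr => i _; rewrite oextE.
exact: (l1_lipschitz_pos_max _ (fun z => oext (dpart f ^~ z))).
Qed.

Lemma DDE n (f : cube n -> R) : DD f = gauss_iter n (grad_sup f) (fun=> 0).
Proof. by []. Qed.

Lemma DD_ge0 n (f : cube n -> R) : 0 <= DD f.
Proof.
rewrite DDE -[leLHS](gauss_iter_cst 0 n (fun=> 0)).
apply: (le_gauss_iter (lexx 0) (grad_norm1_ge0 f) (@l1_lipschitz_cst _ 0)
  (l1_lipschitz_grad_sup f)).
by move=> *; exact: pos_max_ge0.
Qed.

(** Each partial derivative is at most [Lip f] and each [|G i|] has mean [kap]. This is what brings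
    [Lip f] into the final error term. *)
Lemma DD_le n (f : cube n -> R) : DD f <= n%:R * kap * Lip f.
Proof.
have L0 := Lip_ge0 f.
rewrite DDE mulrC -(gauss_iter_sum_norm n (fun=> 0)).
rewrite -(gauss_iterZ _ _ _ ler01 (@l1_lipschitz_sum_norm R n)).
apply: (@le_gauss_iter _ _ n (Lip f) n _ _ _ _ _ _ _ (l1_lipschitz_grad_sup f)) => //.
- exact: grad_norm1_ge0.
- move=> g h; rewrite -mulrBr normrM ger0_norm// ler_wpM2l//.
  by have := @l1_lipschitz_sum_norm R n g h; rewrite mul1r.
move=> h h' hh' _ _; apply: pos_max_le => [|z].
  by rewrite mulr_ge0// sumr_ge0.
rewrite mulr_sumr; apply: ler_sum => i _; rewrite hh'//.
rewrite (le_trans (ler_norm _))// normrM ler_wpM2r//; exact: dpart_le_Lip.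
Qed.

(** Markov's inequality for the exponential of a maximum over the finite family [v], one hull point
    for each point of the cube, followed by [exp_pos_max_le]. *)
Lemma ln_prob_ge_upper n (f : cube n -> R) (p s a M : R) :
  0 < p < 1 -> 0 < a -> 0 <= M -> 0 < prob_ge p f (s + a) ->
  (forall xi, is_product_pm xi -> s <= \sum_z f z * xi z -> M <= KL p xi) ->
  ln (prob_ge p f (s + a)) <= - M + 6 / kap * (M / a) * DD f.
Proof.
move=> p01 a0 M0 P0 HM; set lam := M / a.
have lam0 : 0 <= lam by rewrite divr_ge0// ltW.
have k0 : 0 < kap by rewrite (lt_le_trans _ (gauss_abs_ge R))// invr_gt0.
have : forall y : cube n, exists c : cube n -> R,
    [/\ forall z, 0 <= c z, \sum_z c z <= 1 &
    s + a <= f y -> M <= \sum_(i < n) ((lam * \sum_z c z * dpart f i z) * spin (y i) -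
                       log_laplace p (lam * \sum_z c z * dpart f i z))].
  move=> y; have [sy|ys] := leP (s + a) (f y).
    have Ma : M <= lam * a by rewrite divfK ?gt_eqF.
    by have [c [c0 c1 H]] := mean_field_direction p01 lam0 Ma sy HM; exists c.
  (* Off the event, the hull point 0 serves as default. *)
  by exists (fun=> 0); split => //; rewrite big1// ler01.
move=> /choice[c cP].
pose V y i := lam * \sum_z c y z * dpart f i z.
pose v (y : cube n) := oext (V y).
pose Phi (y : cube n) := expR (pos_max (fun t : cube n =>
  0 + \sum_(i < n) (v t i * spin (y i) - log_laplace p (v t i)))).
have PhiM y : s + a <= f y -> expR M <= Phi y.
  move=> sy; have [_ _ /(_ sy) H] := cP y; rewrite ler_expR (le_trans H)//.
  apply: le_trans (le_pos_max _ y); rewrite add0r.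
  by apply: ler_sum => i _; rewrite /v oextE.
have mu0 y := @mu_p_gt0 _ n p y p01.
have A1 : prob_ge p f (s + a) * expR M <= \sum_y mu_p p y * Phi y.
  rewrite /prob_ge mulr_suml [leRHS](bigID (fun y => s + a <= f y))/= ler_wpDr//.
    by apply: sumr_ge0 => y _; rewrite mulr_ge0 ?expR_ge0// ltW.
  by apply: ler_sum => y sy; rewrite ler_wpM2l ?PhiM// ltW.
have A2 : \sum_y mu_p p y * Phi y <= expR (gauss_iter n (fun G => pos_max (fun t : cube n =>
     0 + \sum_(i < n) 6 / kap * v t i * G i)) (fun=> 0)).
  apply: le_trans (exp_pos_max_le v n (fun=> 0) (fun=> true) (fun=> 0) p01).
  under eq_bigr do rewrite mu_pE.
  rewrite (sum_cube_witer (pweight p) Phi (fun=> true)) le_eqVlt; apply/orP; left; apply/eqP.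
  congr witer; apply/funext => g; rewrite /Phi/=; congr (expR (pos_max _)).
  by apply/funext => t; congr (_ + _); apply: eq_bigr => i _; rewrite ffunE.
(* A linear form on the hull is at most [lam] times its maximum over the gradients and 0. *)
have A3 : gauss_iter n (fun G => pos_max (fun t : cube n =>
     0 + \sum_(i < n) 6 / kap * v t i * G i)) (fun=> 0) <= 6 / kap * lam * DD f.
  set e := 6 / kap * lam.
  have e0 : 0 <= e by rewrite mulr_ge0// divr_ge0// ltW.
  rewrite DDE -(gauss_iterZ _ _ _ _ (l1_lipschitz_grad_sup f)); last exact: grad_norm1_ge0.
  apply: (@le_gauss_iter _ _ n (e * grad_norm1 f) n _ _ _ _ _ _ _
    (l1_lipschitz_pos_max (fun=> 0) (fun (t : cube n) i => 6 / kap * v t i) n)).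
  - exact: (sum_norm_ge0 (fun (t : cube n) i => 6 / kap * v t i) n).
  - by rewrite mulr_ge0//; exact: grad_norm1_ge0.
  - move=> g h; rewrite -mulrBr normrM (ger0_norm e0) -[leRHS]mulrA ler_wpM2l//.
    exact: l1_lipschitz_grad_sup.
  move=> h h' hh' _ _; apply: pos_max_le => [|t].
    by rewrite mulr_ge0// pos_max_ge0.
  have [c0 c1 _] := cP t.
  have -> : 0 + \sum_(i < n) 6 / kap * v t i * h i =
      e * \sum_z c t z * \sum_(i < n) dpart f i z * h' i.
    rewrite add0r; under [in RHS]eq_bigr do rewrite mulr_sumr.
    rewrite exchange_big/= mulr_sumr; apply: eq_bigr => i _.
    rewrite /v oextE /V hh'// /e -!mulrA; congr (_ * (_ * (_ * (_ * _)))).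
    by rewrite mulr_suml; apply: eq_bigr => z _; rewrite mulrA.
  rewrite ler_wpM2l// (@le_trans _ _ (\sum_z c t z * grad_sup f h'))//.
    by apply: ler_sum => z _; rewrite ler_wpM2l//; exact: (le_pos_max (fun z => \sum_(i < n) _)).
  by rewrite -mulr_suml ler_piMl// pos_max_ge0.
have : prob_ge p f (s + a) * expR M <= expR (6 / kap * lam * DD f).
  by rewrite (le_trans A1)// (le_trans A2)// ler_expR.
rewrite -ler_ln ?posrE ?mulr_gt0 ?expR_gt0// lnM ?posrE ?expR_gt0// !expRK.
lra.
Qed.

(** An interpolation: [d^3] is bounded by using the first estimate twice and the second once, which
    produces the exponents 2/3 and 1/3 of [L]. Here [nu], [al] and [be] stand for cube roots and [k]
    for [gauss_abs]. *)
Lemma complexity_error (nu al be d k : R) : 0 <= nu -> 0 <= al -> 0 <= be -> 8^-1 <= k ->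
  0 <= d -> d <= nu ^+ 3 * k * al ^+ 3 / 2 -> d <= be ^+ 3 / 2 ->
  6 * d <= 64 * k * (al ^+ 2 * nu ^+ 2 * be).
Proof.
move=> nu0 al0 be0 k8 d0 d1 d2; have k0 : 0 <= k by lra.
have [m1 m2] : 0 <= al ^+ 2 * nu ^+ 2 * be /\ 0 <= nu ^+ 3 * k * al ^+ 3 / 2.
  by split; rewrite !mulr_ge0// ?exprn_ge0.
rewrite -(@ler_pXn2r _ 3) ?nnegrE//; [|by rewrite mulr_ge0|by rewrite !mulr_ge0].
have h1 : d ^+ 2 <= (nu ^+ 3 * k * al ^+ 3 / 2) ^+ 2 by rewrite ler_sqr ?nnegrE.
have h2 : d ^+ 3 <= (nu ^+ 3 * k * al ^+ 3 / 2) ^+ 2 * (be ^+ 3 / 2).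
  rewrite exprSr; apply: ler_pM => //; exact: sqr_ge0.
rewrite exprMn (le_trans (ler_wpM2l _ h2)) ?exprn_ge0//.
set X := (al ^+ 2 * nu ^+ 2 * be) ^+ 3.
have X0 : 0 <= X by rewrite exprn_ge0.
have -> : 6 ^+ 3 * ((nu ^+ 3 * k * al ^+ 3 / 2) ^+ 2 * (be ^+ 3 / 2)) = 27 * k ^+ 2 * X.
  by rewrite /X; field.
rewrite exprMn -/X ler_wpM2r//.
(* The 27 is [6^3 / 8]; [k >= 1/8] supplies the missing power of [k]. *)
have h3 : 27 * k ^+ 2 <= 64 ^+ 2 * k ^+ 2 * (64 * k).
  have k2 : 0 <= k ^+ 2 by exact: sqr_ge0.
  have : 1 <= 64 * k by lra.
  nra.
by rewrite (le_trans h3)// -exprMn -exprSr.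
Qed.

End complexity.

Unset Implicit Arguments.

Theorem theorem1p8 (R : realType) (n : nat) (f : cube n -> R) (p t delta : R) :
  (0 < n)%N -> 0 < p < 1 -> 0 < delta ->
  (delta%:E < phi p f (t - delta) * (n%:R^-1)%:E)%E ->
  let L := delta^-1 * (2 * Lip f + `|ln (p * (1 - p))|) `^ (2 / 3)
           * (2 * DD f + delta^-1 * Lip f ^+ 2) `^ (1 / 3) in
  (elog (prob_ge p f (t * n%:R))
     <= - phi p f (t - delta) * (1 - 64 * L * n%:R `^ (- (1 / 3)))%:E)%E
  /\
  ((n%:R * delta ^+ 2)^-1 * Lip f ^+ 2 <= 1 / 2 ->
   (elog (prob_ge p f ((t - delta) * n%:R))
     >= - phi p f t * (1 + 2 / (n%:R * delta ^+ 2) * Lip f ^+ 2)%:E - 2%:E)%E).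
Proof.
move=> n0 p01 d0 _ L; have nR : 0 < n%:R :> R by rewrite ltr0n.
have mu0 y := @mu_p_gt0 _ n p y p01.
have pm_ge0 xi : is_product_pm xi -> 0 <= KL p (xi : cube n -> R).
  move=> [m [m0 [m1 xiE]]]; apply: KL_ge0 => // [y|]; first by rewrite xiE prodr_ge0.
  by under eq_bigr do rewrite xiE; exact: sum_prod1.
split.
- have [P0|P0] := eqVneq (prob_ge p f (t * n%:R)) 0.
    by rewrite /elog P0 eqxx leNye.
  have Pp : 0 < prob_ge p f (t * n%:R).
    by rewrite lt_neqAle eq_sym P0/= sumr_ge0// => y _; exact: ltW.
  have [y ty] : exists y, t * n%:R <= f y.
    apply: contrapT => /forallNP H; move/eqP: P0; apply.
    by rewrite /prob_ge big_pred0// => y; apply/negP/H.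
  have inf_le xi : is_product_pm xi -> (t - delta) * n%:R <= \sum_z f z * xi z ->
      (phi p f (t - delta) <= (KL p xi)%:E)%E.
    by move=> ? ?; apply: ereal_inf_lbound; exists xi.
  have [M M0 PhiE] : exists2 M, 0 <= M & phi p f (t - delta) = M%:E.
    have ge0 : (0 <= phi p f (t - delta))%E.
      by apply: le_ereal_inf_tmp => _ [xi [xiP _] <-]; rewrite lee_fin pm_ge0.
    have lty : (phi p f (t - delta) < +oo)%E.
      (* The point mass at [y] is an admissible product measure, so the infimum is finite. *)
      pose m (i : 'I_n) b : R := (b == y i)%:R.
      apply: (@le_lt_trans _ _ (KL p (fun z : cube n => \prod_(i < n) m i (z i)))%:E);
        last exact: ltry.
      apply: inf_le.
        exists m; split=> [i b|]; first by [].
        by split=> // i; rewrite /m; case: (y i); rewrite /= ?addr0 ?add0r.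
      rewrite (bigD1 y)//= [X in f y * X]big1 => [|i _]; last by rewrite /m eqxx.
      rewrite mulr1 big1 ?addr0 => [|z zy].
        by rewrite (le_trans _ ty)// ler_wpM2r// lerBlDr lerDl ltW.
      have [i /negbTE zi] : exists i, z i != y i.
        apply/existsP; rewrite -negb_forall; apply: contra zy => /forallP zy.
        by apply/eqP/ffunP => i; exact/eqP.
      by rewrite (bigD1 i)//= /m zi mul0r mulr0.
    exists (fine (phi p f (t - delta))); first exact: fine_ge0.
    by rewrite fineK// ge0_fin_numE.
  have HM xi : is_product_pm xi -> (t - delta) * n%:R <= \sum_z f z * xi z -> M <= KL p xi.
    by move=> xiP xit; rewrite -lee_fin -PhiE inf_le.
  have tE : t * n%:R = (t - delta) * n%:R + delta * n%:R by ring.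
  have a0 : 0 < delta * n%:R by rewrite mulr_gt0.
  rewrite /elog (negbTE P0) PhiE -EFinN -EFinM lee_fin.
  rewrite tE in Pp *.
  apply: le_trans (ln_prob_ge_upper p01 a0 M0 Pp HM) _.
  rewrite mulrBr mulr1 mulNr opprK lerD2l.
  have D0 := DD_ge0 f; have DL := DD_le f; have L0 := Lip_ge0 f.
  have k8 := gauss_abs_ge R; have k0 : 0 < gauss_abs R by lra.
  set D := DD f in D0 DL *; set A := 2 * Lip f + _ in L *; set B := 2 * D + _ in L *.
  have A2 : 2 * Lip f <= A by rewrite lerDl.
  have B2 : 2 * D <= B by rewrite lerDl mulr_ge0 ?sqr_ge0// invr_ge0 ltW.
  have A0 : 0 <= A by rewrite (le_trans _ A2)// mulr_ge0.
  have B0 : 0 <= B by rewrite (le_trans _ B2)// mulr_ge0.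
  have cube_root (x : R) : 0 <= x -> (x `^ (1 / 3)) ^+ 3 = x.
    move=> x0; rewrite -powR_mulrn ?powR_ge0// -powRrM.
    by rewrite (_ : 1 / 3 * 3%:R = 1) ?powRr1//; field.
  pose al := A `^ (1 / 3); pose be := B `^ (1 / 3); pose nu : R := n%:R `^ (1 / 3).
  have alE : al ^+ 3 = A by exact: cube_root.
  have beE : be ^+ 3 = B by exact: cube_root.
  have nuE : nu ^+ 3 = n%:R by apply: cube_root; exact: ltW.
  have nu0 : 0 < nu by rewrite powR_gt0.
  have LE : L * n%:R `^ (- (1 / 3)) = delta^-1 * al ^+ 2 * be / nu.
    rewrite /L powRN; congr (_ * _ * _ / _).
    have -> : 2 / 3 = 1 / 3 * 2%:R :> R by rewrite mulrAC mul1r.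
    by rewrite powRrM powR_mulrn ?powR_ge0.
  (* The two estimates on [D] are [DL] with [2 * Lip f <= A], and [2 * D <= B]. *)
  have : 6 * D <= 64 * gauss_abs R * (al ^+ 2 * nu ^+ 2 * be).
    apply: complexity_error; rewrite ?powR_ge0//.
    - rewrite alE nuE (le_trans DL)//.
      have nk : 0 <= n%:R * gauss_abs R by rewrite mulr_ge0 ?ltW.
      by have := ler_wpM2l nk A2; lra.
    - by rewrite beE; lra.
  move=> H.
  have -> : 6 / gauss_abs R * (M / (delta * n%:R)) * D =
      M / (delta * nu ^+ 3 * gauss_abs R) * (6 * D).
    by rewrite nuE; field; rewrite !gt_eqF.
  have -> : M * (64 * L * n%:R `^ (- (1 / 3))) =
     M / (delta * nu ^+ 3 * gauss_abs R) * (64 * gauss_abs R * (al ^+ 2 * nu ^+ 2 * be)).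
    by rewrite -(mulrA 64) LE; field; rewrite !gt_eqF.
  by rewrite ler_wpM2l// divr_ge0// !mulr_ge0 ?exprn_ge0// ltW.
- move=> eta2; set X := 1 + _.
  have X0 : 0 < X.
    rewrite ltr_pwDl// mulr_ge0 ?sqr_ge0// divr_ge0// mulr_ge0 ?sqr_ge0//; exact: ltW.
  have [[xi [xiP xit]]|none] := pselect (exists xi : cube n -> R,
      is_product_pm xi /\ t * n%:R <= \sum_y f y * xi y); last first.
    rewrite (_ : phi p f t = +oo%E).
      by rewrite /= mulNyr gtr0_sg// mul1e addNye leNye.
    rewrite /phi (_ : [set xi | _] = set0) ?image_set0 ?ereal_inf0//.
    by apply/seteqP; split => // xi H; apply: none; exists xi.
  have [Q0 _] := ln_prob_ge_lower n0 p01 d0 xiP xit eta2.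
  set Q := prob_ge _ _ _ in Q0 *.
  (* Solving the bound for the entropy makes it uniform over admissible measures, so it passes to
     the infimum without a minimizer. *)
  have lb : (((- 2 - ln Q) / X)%:E <= phi p f t)%E.
    apply: le_ereal_inf_tmp => _ [xi' [xi'P xi't] <-].
    have [_ H] := ln_prob_ge_lower n0 p01 d0 xi'P xi't eta2.
    by rewrite lee_fin ler_pdivrMr//; move: H; rewrite -/X -/Q; lra.
  rewrite /elog gt_eqF//; move: lb; case: (phi p f t) => [r| |] //.
  + rewrite -EFinN -EFinM -EFinB !lee_fin ler_pdivrMr//; lra.
  + by rewrite /= mulNyr gtr0_sg// mul1e addNye leNye.
Qed.
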